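(* For any acyclic directed graph $G$, there is a bijection between the set of upward planar orders on $G$ and the set of CPP-extensions of $G$.
   Context: Directed graphs are finite; parallel edges are allowed. $s(e),t(e)$ are the starting and ending vertices of an edge $e$. For a vertex $v$, $I(v)$ and $O(v)$ are the sets of incoming and outgoing edges and $E(v)=I(v)\cup O(v)$. A source (sink) is a vertex with no incoming (outgoing) edge; $S(G)$, $T(G)$ are the sets of sources and sinks of $G$. For edges $e_1\ne e_2$, $e_1\rightarrow e_2$ means there is a directed path starting from $e_1$ and ending with $e_2$. For a finite set with a linear order $\prec$ and a nonempty subset $X$, $X^-=\min X$, $X^+=\max X$, $\overline{X}=\{y: X^-\preceq y\preceq X^+\}$; $\overline{\emptyset}=\emptyset$. An upward planar order on $G$ is a linear order $\prec$ on the edge set $E(G)$ such that: $(U_1)$ $e_1\rightarrow e_2$ implies $e_1\prec e_2$; $(U_2)$ for any vertex $v$, $\overline{I(v)}\cap\overline{O(v)}=\emptyset$ and $\overline{E(v)}=\overline{I(v)}\sqcup\overline{O(v)}$; $(U_3)$ for any two vertices $v_1,v_2$, $I(v_1)\cap\overline{I(v_2)}\neq\emptyset$ implies $\overline{I(v_1)}\subseteq\overline{I(v_2)}$, and $O(v_1)\cap\overline{O(v_2)}\neq\emptyset$ implies $\overline{O(v_1)}\subseteq\overline{O(v_2)}$. A processive graph is an acyclic directed graph in which all sources and sinks have degree one. For a processive graph $\Gamma$, $I(\Gamma)$ is the set of its input edges (those starting from a source) and $O(\Gamma)$ the set of its output edges (those ending with a sink). A planar order on a processive graph is a linear order $\prec$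 on its edge set such that $(P_1)$ $e_1\rightarrow e_2$ implies $e_1\prec e_2$; $(P_2)$ if $e_1\prec e_2\prec e_3$ and $e_1\rightarrow e_3$, then $e_1\rightarrow e_2$ or $e_2\rightarrow e_3$. A POP-graph is a processive graph together with a planar order. An embedding $\phi\colon G_1\to G_2$ of directed graphs is a pair of injections $\phi_0\colon V(G_1)\to V(G_2)$, $\phi_1\colon E(G_1)\to E(G_2)$ with $s(\phi_1(e))=\phi_0(s(e))$ and $t(\phi_1(e))=\phi_0(t(e))$ for all $e\in E(G_1)$. A CPP-extension (canonical processive planar extension) of $G$ is a POP-graph $(\Gamma,\prec)$ together with an embedding $\phi\colon G\to\Gamma$ such that: $(E_1)$ $\phi_0(V(G))=V(\Gamma)-(S(\Gamma)\sqcup T(\Gamma))$; $(E_2)$ $|E(\Gamma)|=|E(G)|+|S(G)|+|T(G)|$; $(E_3)$ $I(\phi_0(v))\cap O(\phi_0(w))=\emptyset$ for any $v\in S(G)$ and $w\in T(G)$; $(E_4)$ $e\in E(\Gamma)-(\phi_1(E(G))\cup I(\Gamma)\cup O(\Gamma))$ implies that either $O(s(e))^-\prec e\prec O(s(e))^+$ or $I(t(e))^-\prec e\prec I(t(e))^+$. CPP-extensions $\phi\colon G\to(\Gamma,\prec)$ and $\phi'\colon G\to(\Gamma',\prec')$ are identified when there is an order-preserving isomorphism of directed graphs $\lambda\colon\Gamma\to\Gamma'$ with $\phi'=\lambda\circ\phi$.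
   Formalization: The graph G is additionally assumed to have no isolated vertices; without this the claim fails: one edge a→b together with an isolated vertex has one upward planar order but two CPP-extensions. *)

(* Defs.v *)
From mathcomp Require Import all_boot.

Set Implicit Arguments.
Unset Strict Implicit.
Unset Printing Implicit Defensive.

Record digraph := Digraph {
  vertex : finType;
  edge : finType;
  src : edge -> vertex;
  tgt : edge -> vertex }.

Section Digraph.
Variable G : digraph.
Implicit Types (v : vertex G) (e : edge G).

Definition in_edges v : {set edge G} := [set e | tgt e == v].
Definition out_edges v : {set edge G} := [set e | src e == v].
Definition incident_edges v := in_edges v :|: out_edges v.

Definition sources : {set vertex G} := [set v | #|in_edges v| == 0].
Definition sinks : {set vertex G} := [set v | #|out_edges v| == 0].

Definition consecutive : rel (edge G) := [rel e1 e2 | tgt e1 == src e2].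

(* [cycle] holds of the empty sequence, which is not a directed cycle. *)
Definition acyclic := forall c : seq (edge G), cycle consecutive c -> c = [::].

Definition reaches : rel (edge G) :=
  [rel e1 e2 | (e1 != e2) && connect consecutive e1 e2].

(* An order on the edges does not see isolated vertices, whereas a CPP-extension
   puts an edge into and an edge out of each of them, in an order that can vary:
   an edge a -> b next to an isolated vertex has one upward planar order but two
   CPP-extensions. *)
Definition no_isolated_vertex := forall v, #|incident_edges v| != 0.

Definition degree v := #|in_edges v| + #|out_edges v|.

Definition processive :=
  acyclic /\ forall v, v \in sources :|: sinks -> degree v = 1.

Definition input_edges : {set edge G} := [set e | src e \in sources].
Definition output_edges : {set edge G} := [set e | tgt e \in sinks].

End Digraph.

Section LinearOrder.
Variables (T : finType) (lt : rel T).

Definition strict_linear_order :=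
  [/\ irreflexive lt, transitive lt & forall x y, x != y -> lt x y || lt y x].

Definition preceq : rel T := [rel x y | (x == y) || lt x y].

Definition is_min (X : {set T}) m := (m \in X) && [forall x in X, preceq m x].
Definition is_max (X : {set T}) m := (m \in X) && [forall x in X, preceq x m].

(* The interval between min X and max X; empty when X is, since X then has
   no minimum. *)
Definition hull (X : {set T}) : {set T} :=
  [set y | [exists a, exists b,
     [&& is_min X a, is_max X b, preceq a y & preceq y b]]].

Definition strictly_inside (X : {set T}) y :=
  exists a b, [&& is_min X a, is_max X b, lt a y & lt y b].

End LinearOrder.

Definition upward_planar_order (G : digraph) (lt : rel (edge G)) :=
  [/\ strict_linear_order lt,
      forall e1 e2, reaches e1 e2 -> lt e1 e2,
      forall v : vertex G,
        [disjoint hull lt (in_edges v) & hull lt (out_edges v)] /\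
        hull lt (incident_edges v) =
          hull lt (in_edges v) :|: hull lt (out_edges v)
    & forall v1 v2 : vertex G,
        (in_edges v1 :&: hull lt (in_edges v2) != set0 ->
           hull lt (in_edges v1) \subset hull lt (in_edges v2)) /\
        (out_edges v1 :&: hull lt (out_edges v2) != set0 ->
           hull lt (out_edges v1) \subset hull lt (out_edges v2))].

Definition planar_order (G : digraph) (lt : rel (edge G)) :=
  [/\ strict_linear_order lt,
      forall e1 e2, reaches e1 e2 -> lt e1 e2
    & forall e1 e2 e3, lt e1 e2 -> lt e2 e3 -> reaches e1 e3 ->
        reaches e1 e2 \/ reaches e2 e3].

Record pop_graph := PopGraph {
  pop_digraph :> digraph;
  pop_lt : rel (edge pop_digraph);
  pop_processive : processive pop_digraph;
  pop_planar : planar_order pop_lt }.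

Record embedding (G1 G2 : digraph) := Embedding {
  emb_v : vertex G1 -> vertex G2;
  emb_e : edge G1 -> edge G2;
  emb_v_inj : injective emb_v;
  emb_e_inj : injective emb_e;
  emb_src : forall e, src (emb_e e) = emb_v (src e);
  emb_tgt : forall e, tgt (emb_e e) = emb_v (tgt e) }.

Record cpp_extension (G : digraph) := CppExtension {
  cpp_pop : pop_graph;
  cpp_emb : embedding G cpp_pop;
  cpp_vertices :
    emb_v cpp_emb @: [set: vertex G] = ~: (sources cpp_pop :|: sinks cpp_pop);
  cpp_card_edges :
    #|edge cpp_pop| = #|edge G| + #|sources G| + #|sinks G|;
  cpp_source_sink : forall v w : vertex G, v \in sources G -> w \in sinks G ->
    in_edges (emb_v cpp_emb v) :&: out_edges (emb_v cpp_emb w) = set0;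
  (* Input and output edges must all be exempted, not only those that are both:
     an input edge into a source of G is alone at both its ends, so it is never
     strictly between two others there. *)
  cpp_new_edges : forall e : edge cpp_pop,
    e \notin emb_e cpp_emb @: [set: edge G]
               :|: (input_edges cpp_pop :|: output_edges cpp_pop) ->
    strictly_inside (@pop_lt cpp_pop) (out_edges (src e)) e \/
    strictly_inside (@pop_lt cpp_pop) (in_edges (tgt e)) e }.

Definition cpp_iso (G : digraph) (X Y : cpp_extension G) :=
  exists (l0 : vertex (cpp_pop X) -> vertex (cpp_pop Y))
         (l1 : edge (cpp_pop X) -> edge (cpp_pop Y)),
    [/\ bijective l0 /\ bijective l1,
        forall e, src (l1 e) = l0 (src e) /\ tgt (l1 e) = l0 (tgt e),
        forall e1 e2, pop_lt e1 e2 = pop_lt (l1 e1) (l1 e2),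
        forall v, emb_v (cpp_emb Y) v = l0 (emb_v (cpp_emb X) v)
      & forall e, emb_e (cpp_emb Y) e = l1 (emb_e (cpp_emb X) e)].

Definition upo (G : digraph) := {lt : rel (edge G) | upward_planar_order lt}.

(* CPP-extensions identified along [cpp_iso]: the type of isomorphism classes.
   Classes are plain predicates rather than classical [set]s because the
   universe of [set] lies strictly below that of [finType]. *)
Definition cpp_class (G : digraph) :=
  {C : cpp_extension G -> Prop | exists X, forall Y, C Y <-> cpp_iso X Y}.

(* Main.v *)
(** The map from CPP-extensions to upward planar orders is restriction to [G];
    everything else is in showing that it is injective up to isomorphism and
    onto.  An extension has exactly one new edge into each source [u] of [G] and
    one new edge out of each sink.  Planarity forces the new edge into [u] to
    come immediately before the first edge out of [u], and to start at the
    innermost vertex [w] of [G] such that the edges out of [u] lie between edges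
    out of [w], or at a new source if there is no such [w]; dually for sinks.
    Hence the restricted order determines the extension.  Conversely, adding
    edges to an upward planar order by this rule gives a planar order, because
    every edge lying between two edges out of a vertex [v] can then be reached
    from [v].  Statements about sinks are obtained from those about sources by
    reversing all edges and the order. *)

Require Import Defs.
From mathcomp Require Import all_boot.
From mathcomp Require Import zify boolp.

Set Implicit Arguments.
Unset Strict Implicit.
Unset Printing Implicit Defensive.

(** * Linear orders, connectivity and reversal *)

(** In [G] alone, an edge out of a source may lie between two edges out of [w] without being
    reachable from [w], and then (P2) can fail; the new edge from the parent supplies the missing
    path. Conversely, (E4) forces the first and the last edge out of a vertex of [G] that is not a
    sink to be edges of [G]. A vertex therefore spans the same edges of [G] in the extension as in
    [G], and laminarity of the planar order restricts to (U3). The two directions meet in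
    [canonical_extension], which speaks of the position and the ends of the new edges and not of
    planarity. It holds for the constructed graph and for every CPP-extension, and both planarity
    and uniqueness are derived from it. The notions are phrased so that reversing twice gives back
    the same statement up to conversion; the half about sinks is the half about sources instantiated
    at [opg G] and [oplt lt]. *)

Definition oplt (T : Type) (lt : rel T) : rel T := fun x y => lt y x.

Section LinearOrders.
Variables (T : finType) (lt : rel T).
Hypothesis lin : strict_linear_order lt.

(** Counting predecessors turns comparisons of edges into comparisons of naturals, so that chains of
    weak and strict inequalities can be left to [lia]. *)
Lemma linear_rank :
  exists rk : T -> nat, injective rk /\ forall x y, lt x y = (rk x < rk y).
Proof.
have [irr trans tot] := lin; pose rk x := #|[set z | lt z x]|.
have rk_lt x y : lt x y -> rk x < rk y.
  move=> xy; apply/proper_card/properP; split.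
    by apply/subsetP => z; rewrite !inE => /trans; apply.
  by exists x; rewrite !inE // irr.
have ltE x y : lt x y = (rk x < rk y).
  case: (eqVneq x y) => [->|/tot]; first by rewrite irr ltnn.
  case/orP => [xy|yx]; first by rewrite xy rk_lt.
  have yx' := rk_lt _ _ yx; rewrite ltnNge (ltnW yx') /=.
  by apply/negP => /trans/(_ yx); rewrite irr.
exists rk; split=> // x y E; apply/eqP/negP => /negP/tot.
by rewrite !ltE E ltnn.
Qed.

Lemma oplt_linear : strict_linear_order (oplt lt).
Proof.
have [irr trans tot] := lin; split=> [x|y x z xy yz|x y /tot].
- exact: irr.
- exact: trans yz xy.
- by rewrite orbC.
Qed.

Lemma lt_min (P : pred T) x : P x ->
  exists2 m, P m & forall y, P y -> ~~ lt y m.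
Proof.
have [rk [_ ltE]] := linear_rank => Px.
by case: (arg_minnP rk Px) => m Pm mP; exists m => // y /mP; rewrite ltE -leqNgt.
Qed.

Lemma preceqE x y : preceq lt x y = ~~ lt y x.
Proof.
have [rk [rkI ltE]] := linear_rank.
by rewrite /preceq /= !ltE -leqNgt [RHS]leq_eqVlt (inj_eq rkI).
Qed.

End LinearOrders.

Section Hulls.
Variables (T : finType) (lt : rel T).
Hypothesis lin : strict_linear_order lt.

(** The extremal elements need not be named: any two elements of [X] around [y] have the minimum and
    the maximum further out. *)
Lemma hullP (X : {set T}) y :
  y \in hull lt X <->
  exists a b, [/\ a \in X, b \in X, ~~ lt y a & ~~ lt b y].
Proof.
rewrite inE; split.
  case/existsP=> a /existsP[b /and4P[/andP[aX _] /andP[bX _]]].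
  by rewrite !(preceqE lin) => ya yb; exists a, b.
have [rk [_ ltE]] := linear_rank lin.
case=> a [b [aX bX ya yb]].
have [m mX mP] := lt_min lin (P := mem X) aX.
have [n nX nP] := lt_min (oplt_linear lin) (P := mem X) bX.
have am := mP _ aX; have bn := nP _ bX.
rewrite /oplt !ltE in ya yb am bn.
apply/existsP; exists m; apply/existsP; exists n.
rewrite !(preceqE lin) !ltE; apply/and4P; split; try lia.
- by apply/andP; split=> //; apply/forallP => z; apply/implyP => /mP; rewrite (preceqE lin).
- by apply/andP; split=> //; apply/forallP => z; apply/implyP => /nP; rewrite (preceqE lin).
Qed.

Lemma strictly_insideP (X : {set T}) y :
  strictly_inside lt X y <->
  exists a b, [/\ a \in X, b \in X, lt a y & lt y b].
Proof.
split.
  by case=> a [b /and4P[/andP[aX _] /andP[bX _]]] ? ?; exists a, b.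
have [rk [_ ltE]] := linear_rank lin.
case=> a [b [aX bX ya yb]].
have [m mX mP] := lt_min lin (P := mem X) aX.
have [n nX nP] := lt_min (oplt_linear lin) (P := mem X) bX.
have am := mP _ aX; have bn := nP _ bX.
rewrite /oplt !ltE in ya yb am bn.
exists m, n; rewrite !ltE; apply/and4P; split; try lia.
- by apply/andP; split=> //; apply/forallP => z; apply/implyP => /mP; rewrite (preceqE lin).
- by apply/andP; split=> //; apply/forallP => z; apply/implyP => /nP; rewrite (preceqE lin).
Qed.

End Hulls.

Section Connect.
Variables (T : finType) (e : rel T).

Lemma connect_first x y :
  connect e x y -> x = y \/ exists2 z, e x z & connect e z y.
Proof.
case/connectP=> [[|z p]] /= => [_ ->|/andP[xz zp] ->]; [by left|right].
by exists z => //; apply/connectP; exists p.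
Qed.

Lemma connect_last x y :
  connect e x y -> x = y \/ exists2 z, connect e x z & e z y.
Proof.
case/connectP=> p; elim/last_ind: p => [|p z _] /=; first by left.
rewrite rcons_path last_rcons => /andP[xp pz] ->; right.
by exists (last x p) => //; apply/connectP; exists p.
Qed.

(** The path starts below [y] and ends above it, so its first entry that is not below [y] is either
    [y] itself or the end of a step over [y]. *)
Lemma connect_jump (lt : rel T) x y z : strict_linear_order lt ->
  connect e x z -> lt x y -> lt y z ->
  connect e x y /\ connect e y z \/
  exists p q, [/\ connect e x p, e p q, connect e q z, lt p y & lt y q].
Proof.
case=> irr trans tot /connectP[p + ->]; elim: p x => [|w p IHp] x /=.
  by move=> _ xy /(trans _ _ _ xy); rewrite irr.
case/andP=> xw wp xy yz.
have wz : connect e w (last w p) by apply/connectP; exists p.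
have [<-|/tot/orP[wy|yw]] := eqVneq w y.
- by left; split=> //; exact: connect1.
- have [[wy' yz']|[a [b [wa ab bz ay yb]]]] := IHp w wp wy yz.
    by left; split=> //; apply: connect_trans wy'; exact: connect1.
  by right; exists a, b; split=> //; apply: connect_trans wa; exact: connect1.
- by right; exists x, w; split.
Qed.

End Connect.

Lemma acyclic_of_lt (G : digraph) (lt : rel (edge G)) :
  strict_linear_order lt -> (forall x y, consecutive x y -> lt x y) -> acyclic G.
Proof.
case=> irr trans _ sub [|x p] //= /(sub_path sub) xp.
have := order_path_min trans xp; rewrite all_rcons => /andP[].
by rewrite irr.
Qed.

Lemma acyclic_consecutive (G : digraph) (x y : edge G) :
  acyclic G -> consecutive x y -> reaches x y.
Proof.
move=> acG xy; rewrite /reaches /= connect1 // andbT.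
apply/eqP => E; have /acG// : cycle (@consecutive G) [:: x].
by rewrite /= andbT; move: xy; rewrite -E.
Qed.

Lemma connect_le (G : digraph) (lt : rel (edge G)) x y :
  strict_linear_order lt -> (forall x y, reaches x y -> lt x y) ->
  connect (@consecutive G) x y -> ~~ lt y x.
Proof.
case=> irr trans tot sub xy; case: (eqVneq x y) => [->|ne]; first by rewrite irr.
have /sub xy' : reaches x y by rewrite /reaches /= ne.
by apply/negP => /trans/(_ xy'); rewrite irr.
Qed.

Definition opg (G : digraph) : digraph := Digraph (@tgt G) (@src G).

Lemma consecutive_op (G : digraph) (x y : edge G) :
  @consecutive (opg G) x y = @consecutive G y x.
Proof. exact: eq_sym. Qed.

Lemma connect_op (G : digraph) (x y : edge G) :
  connect (@consecutive (opg G)) x y = connect (@consecutive G) y x.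
Proof.
have /= <- := connect_rev (@consecutive G) x y; apply: eq_connect => a b.
exact: consecutive_op.
Qed.

Lemma reaches_op (G : digraph) (x y : edge G) :
  @reaches (opg G) x y = @reaches G y x.
Proof. by rewrite /reaches /= connect_op eq_sym. Qed.

Lemma acyclic_op (G : digraph) : acyclic G -> acyclic (opg G).
Proof.
move=> acG c cyc; have /acG /(congr1 rev) : cycle (@consecutive G) (rev c).
  by rewrite rev_cycle; apply: sub_cycle cyc => x y; rewrite consecutive_op.
by rewrite revK.
Qed.

Lemma planar_op (G : digraph) (lt : rel (edge G)) :
  planar_order lt -> @planar_order (opg G) (oplt lt).
Proof.
case=> lin P1 P2; split; first exact: oplt_linear.
  by move=> x y; rewrite reaches_op => /P1.
move=> x y z xy yz; rewrite !reaches_op => /(P2 _ _ _ yz xy) [|]; by [left|right].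
Qed.

Lemma processive_op (G : digraph) : processive G -> processive (opg G).
Proof.
case=> acG deg; split; first exact: acyclic_op.
by move=> v; rewrite setUC => /deg; rewrite /degree addnC.
Qed.

(** * Upward planar orders in terms of edges *)

(* The weak order is written [~~ lt y x], so that it is turned into its
   converse by [oplt] up to conversion. *)
Definition spans (G : digraph) (lt : rel (edge G)) (w : vertex G) y :=
  exists a b, [/\ src a = w, src b = w, ~~ lt y a & ~~ lt b y].

Definition nested (G : digraph) (lt : rel (edge G)) (v w : vertex G) :=
  forall c, src c = v -> spans lt w c.

Definition laminar (G : digraph) (lt : rel (edge G)) :=
  forall w e, spans lt w e -> nested lt (src e) w.

(** This is what remains of (U2) once the edges into a vertex precede those out of it: an edge
    between the two kinds lies in one of the two hulls. *)
Definition no_gap (G : digraph) (lt : rel (edge G)) :=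
  forall (a b x : edge G), tgt a = src b -> lt a x -> lt x b ->
    (exists2 a', tgt a' = tgt a & ~~ lt a' x) \/
    (exists2 b', src b' = src b & ~~ lt x b').

Definition upward_planar_edgewise (G : digraph) (lt : rel (edge G)) :=
  [/\ strict_linear_order lt, forall x y : edge G, consecutive x y -> lt x y,
      no_gap lt, laminar lt & @laminar (opg G) (oplt lt)].

Lemma upward_planar_edgewise_op (G : digraph) (lt : rel (edge G)) :
  upward_planar_edgewise lt -> @upward_planar_edgewise (opg G) (oplt lt).
Proof.
case=> lin U1 U2 U3 U3'; split=> //.
- exact: oplt_linear.
- by move=> x y; rewrite consecutive_op => /U1.
- move=> a b x ab ax xb; case: (U2 b a x) => //.
    by case=> c ? ?; right; exists c.
  by case=> c ? ?; left; exists c.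
Qed.

Lemma in_edgesE (G : digraph) v (e : edge G) : (e \in in_edges v) = (tgt e == v).
Proof. by rewrite inE. Qed.

Lemma out_edgesE (G : digraph) v (e : edge G) : (e \in out_edges v) = (src e == v).
Proof. by rewrite inE. Qed.

Lemma hull_out (G : digraph) (lt : rel (edge G)) v y : strict_linear_order lt ->
  y \in hull lt (out_edges v) <-> spans lt v y.
Proof.
move=> lin; split=> [/(hullP lin)|].
  by case=> a [b]; rewrite !inE => -[/eqP ? /eqP ? ? ?]; exists a, b.
case=> a [b [/eqP ? /eqP ? ? ?]]; apply/(hullP lin).
by exists a, b; rewrite !inE.
Qed.

Lemma hull_in (G : digraph) (lt : rel (edge G)) v y : strict_linear_order lt ->
  y \in hull lt (in_edges v) <-> @spans (opg G) (oplt lt) v y.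
Proof.
move=> lin; split=> [/(hullP lin)|].
  by case=> a [b]; rewrite !inE => -[/eqP ? /eqP ? ? ?]; exists b, a.
case=> a [b [/eqP ? /eqP ? ? ?]]; apply/(hullP lin).
by exists b, a; rewrite !inE.
Qed.

(** Monotonicity on consecutive edges yields (U1) by transitivity and the disjointness in (U2);
    [no_gap] yields the equation between hulls. Acyclicity excludes loops, which are consecutive to
    themselves although [reaches] is irreflexive. *)
Lemma upward_planar_orderP (G : digraph) (lt : rel (edge G)) : acyclic G ->
  upward_planar_order lt <-> upward_planar_edgewise lt.
Proof.
move=> acG; split.
  case=> lin U1 U2 U3; split=> //.
  - by move=> x y /(acyclic_consecutive acG) /U1.
  - move=> a b x ab ax xb; have [_] := U2 (tgt a).
    have [rk [_ ltE]] := linear_rank lin; rewrite !ltE in ax xb.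
    have : x \in hull lt (incident_edges (tgt a)).
      apply/(hullP lin); exists a, b; rewrite !ltE !inE ab eqxx orbT.
      by split=> //; lia.
    move=> /[swap] ->; rewrite inE => /orP[/(hullP lin)|/(hullP lin)].
      case=> c [d []]; rewrite !inE => _ /eqP dv _ dx.
      by left; exists d.
    case=> c [d []]; rewrite !inE => /eqP dv _ cx _.
    by right; exists c; rewrite -?ab.
  - move=> w e /(hull_out _ _ lin) ew c cv; apply/(hull_out _ _ lin).
    have [_ H] := U3 (src e) w; apply: (subsetP (H _)).
      by apply/set0Pn; exists e; rewrite in_setI ew inE eqxx.
    apply/(hull_out _ _ lin); exists c, c; split=> //; by case: lin => ->.
  - move=> w e /(hull_in _ _ lin) ew c cv; apply/(hull_in _ _ lin).
    have [H _] := U3 (@tgt G e) w; apply: (subsetP (H _)).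
      by apply/set0Pn; exists e; rewrite in_setI ew inE eqxx.
    apply/(hull_in _ _ lin); exists c, c; rewrite /oplt; split=> //; by case: lin => ->.
case=> lin U1 U2 U3 U3'.
have [rk [rkI ltE]] := linear_rank lin.
split=> //.
- move=> x y /andP[/eqP ne /connect_last [//|[z + zy]]].
  move=> xz; have {xz} : rk x <= rk z; last by have := U1 _ _ zy; rewrite !ltE; lia.
  case/connectP: xz => p + -> {ne}; elim: p x => //= a p IHp x /andP[/U1 xa /IHp].
  by rewrite ltE in xa; lia.
- have IO v a b : a \in in_edges v -> b \in out_edges v -> rk a < rk b.
    by rewrite !inE -ltE => /eqP av /eqP bv; apply: U1; rewrite /consecutive /= av bv.
  move=> v; split.
    apply/pred0P => x /=; apply/negP => /andP[].
    move=> /(hullP lin)[_ [a [_ av _ +]]] /(hullP lin)[b [_ [bv _ + _]]].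
    by rewrite !ltE; have := IO _ _ _ av bv; lia.
  apply/setP => x; rewrite in_setU; apply/idP/orP.
    case/(hullP lin)=> a [b []].
    rewrite /incident_edges !in_setU => /orP[] av /orP[] bv xa bx.
    + by left; apply/(hullP lin); exists a, b.
    (* The case that needs [no_gap]: [x] lies between an edge into [v] and an edge out of [v]. *)
    + case: (eqVneq x a) => [->|ne_a].
        by left; apply/(hullP lin); exists a, a; rewrite !ltE ltnn.
      case: (eqVneq x b) => [->|ne_b].
        by right; apply/(hullP lin); exists b, b; rewrite !ltE ltnn.
      have av' : tgt a = v by move: av; rewrite inE => /eqP.
      have bv' : src b = v by move: bv; rewrite inE => /eqP.
      case: (U2 a b x); rewrite ?av' ?bv' //.
      * have : rk x <> rk a by move/rkI/eqP; apply/negP.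
        by rewrite !ltE in xa bx *; lia.
      * have : rk x <> rk b by move/rkI/eqP; apply/negP.
        by rewrite !ltE in xa bx *; lia.
      * by case=> c cv cx; left; apply/(hullP lin); exists a, c; rewrite !inE av' cv.
      * by case=> c cv cx; right; apply/(hullP lin); exists c, b; rewrite !inE cv bv'.
    + by have := IO _ _ _ bv av; rewrite !ltE in xa bx; lia.
    + by right; apply/(hullP lin); exists a, b.
  by case=> /(hullP lin)[a [b [av bv xa bx]]]; apply/(hullP lin);
     exists a, b; rewrite /incident_edges !in_setU av bv ?orbT.
- move=> v w; split=> /set0Pn[e]; rewrite in_setI => /andP[].
    rewrite in_edgesE => /eqP ev /(hull_in _ _ lin) /U3'; rewrite /= ev => vw.
    apply/subsetP => x /(hullP lin)[a [b []]]; rewrite !in_edgesE.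
    move=> /eqP/vw[_ [a' [_ /eqP av _ a1]]] /eqP/vw[b' [_ [/eqP bv _ b1 _]]] xa bx.
    apply/(hullP lin); exists a', b'; rewrite !in_edgesE.
    by rewrite /oplt !ltE in xa bx a1 b1 *; split=> //; lia.
  rewrite out_edgesE => /eqP ev /(hull_out _ _ lin) /U3; rewrite /= ev => vw.
  apply/subsetP => x /(hullP lin)[a [b []]]; rewrite !out_edgesE.
  move=> /eqP/vw[a' [_ [av _ a1 _]]] /eqP/vw[_ [b' [_ bv _ b1]]] xa bx.
  apply/(hullP lin); exists a', b'; rewrite !out_edgesE av bv eqxx.
  by rewrite !ltE in xa bx a1 b1 *; split=> //; lia.
Qed.

(** * The canonical extension of an upward planar order *)

(** One spanned edge out of [u] is enough to ask for, since laminarity extends spanning to all the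
    others. *)
Definition encloses (G : digraph) (lt : rel (edge G)) (w u : vertex G) :=
  w <> u /\ exists2 e, src e = u & spans lt w e.

Definition parent (G : digraph) (lt : rel (edge G)) (u w : vertex G) :=
  encloses lt w u /\ forall w', encloses lt w' u -> nested lt w w'.

(** Sinks are represented as [source_of (opg G)], so that statements about sources apply to them
    after reversal. *)
Definition source_of (G : digraph) := {v : vertex G | v \in sources G}.

Definition op_emb (G H : digraph) (f : embedding G H) :
    embedding (opg G) (opg H) :=
  @Embedding (opg G) (opg H) _ _ (@emb_v_inj _ _ f) (@emb_e_inj _ _ f)
    (emb_tgt f) (emb_src f).

(* The third and fourth clauses put [i u] immediately before the first edge
   out of [u]; the last one says that [i u] starts from a source of degree one
   when [u] has no parent. *)
Definition attached (G H : digraph) (ltH : rel (edge H)) (lt : rel (edge G))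
    (f : embedding G H) (i : source_of G -> edge H) :=
  [/\ forall u, tgt (i u) = emb_v f (val u),
      forall u w, src (i u) = emb_v f w <-> parent lt (val u) w,
      forall u e, src e = val u -> ltH (i u) (emb_e f e),
      forall u y, (forall e, src e = val u -> ltH y (emb_e f e)) ->
        ~~ ltH (i u) y
    & forall u, (forall w, src (i u) <> emb_v f w) ->
        forall x, tgt x <> src (i u) /\ (src x = src (i u) -> x = i u)].

Record canonical_extension (G H : digraph) (ltH : rel (edge H)) (lt : rel (edge G))
    (f : embedding G H) (i : source_of G -> edge H)
    (o : source_of (opg G) -> edge H) : Prop := Canonical {
  cext_lin : strict_linear_order ltH;
  cext_mono : forall x y, ltH (emb_e f x) (emb_e f y) = lt x y;
  cext_surj : forall x, [\/ exists e, x = emb_e f e, exists u, x = i u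
                         | exists w, x = o w];
  cext_i : attached ltH lt f i;
  cext_o : @attached (opg G) (opg H) (oplt ltH) (oplt lt) (op_emb f) o }.

(** Double reversal is invisible up to conversion, so the two [attached] clauses simply trade
    places. *)
Lemma canonical_op (G H : digraph) (ltH : rel (edge H)) (lt : rel (edge G))
    (f : embedding G H) i o :
  canonical_extension ltH lt f i o ->
  @canonical_extension (opg G) (opg H) (oplt ltH) (oplt lt) (op_emb f) o i.
Proof.
case=> lin mono surj Hi Ho; split=> //.
- exact: oplt_linear.
- by move=> x y; apply: mono.
- by move=> x; case: (surj x) => ?; [apply: Or31|apply: Or33|apply: Or32].
Qed.

Lemma isolated_op (G : digraph) :
  no_isolated_vertex G -> no_isolated_vertex (opg G).
Proof. by move=> noiso v; rewrite /incident_edges setUC; apply: noiso. Qed.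

Lemma source_tgt (G : digraph) (u : source_of G) e : tgt e <> val u.
Proof.
move=> eu; have := valP u; rewrite inE => /eqP/cards0_eq/setP/(_ e).
by rewrite !inE eu eqxx.
Qed.

Lemma source_src (G : digraph) (u : source_of G) :
  no_isolated_vertex G -> exists e, src e = val u.
Proof.
move=> /(_ (val u)); rewrite -lt0n => /card_gt0P[e].
by rewrite !inE => /orP[/eqP/source_tgt|/eqP]; last by exists e.
Qed.

Definition ext_edge (G : digraph) : finType :=
  (edge G + (source_of G + source_of (opg G)))%type.

Definition all_edges (G H : digraph) (f : embedding G H) (i : source_of G -> edge H)
    (o : source_of (opg G) -> edge H) (x : ext_edge G) : edge H :=
  match x with inl e => emb_e f e | inr (inl u) => i u | inr (inr w) => o w end.

Lemma all_edges_inj_of (G H : digraph) (f : embedding G H) i o :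
  (forall u, tgt (i u) = emb_v f (val u)) ->
  (forall w, src (o w) = emb_v f (val w)) ->
  (forall u w, i u <> o w) -> injective (all_edges f i o).
Proof.
move=> tgt_i src_o io.
have fi e u : emb_e f e <> i u.
  by move/(congr1 (@tgt _)); rewrite emb_tgt tgt_i => /emb_v_inj/source_tgt.
have fo e w : emb_e f e <> o w.
  move/(congr1 (@src _)); rewrite emb_src src_o => /emb_v_inj.
  exact: (@source_tgt (opg G)).
case=> [e|[u|w]] [e'|[u'|w']] /= E.
- by rewrite (emb_e_inj E).
- by case: (fi _ _ E).
- by case: (fo _ _ E).
- by case: (fi _ _ (esym E)).
- by have := tgt_i u; rewrite E tgt_i => /emb_v_inj/val_inj ->.
- by case: (io _ _ E).
- by case: (fo _ _ (esym E)).
- by case: (io _ _ (esym E)).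
- by have := src_o w; rewrite E src_o => /emb_v_inj/val_inj ->.
Qed.

Section Canonical.
Variables (G H : digraph) (ltH : rel (edge H)) (lt : rel (edge G)).
Variables (f : embedding G H).
Variables (i : source_of G -> edge H) (o : source_of (opg G) -> edge H).
Hypothesis upl : upward_planar_edgewise lt.
Hypothesis can : canonical_extension ltH lt f i o.

Lemma emb_neq_in e u : emb_e f e <> i u.
Proof.
case: (cext_i can) => tgt_i _ _ _ _ /(congr1 (@tgt H)).
by rewrite emb_tgt tgt_i => /emb_v_inj/source_tgt.
Qed.

(** A common edge would start at the sink [w] and make [w] the parent of [u], but a parent has
    outgoing edges. *)
Lemma in_neq_out u w : i u <> o w.
Proof.
case: (cext_i can) => _ par _ _ _; case: (cext_o can) => /= src_o _ _ _ _ E.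
have := src_o w; rewrite -E => /par[[_ [_ _ [a [_ [aw _ _ _]]]]] _].
exact: (@source_tgt (opg G) w a).
Qed.

Lemma parent_below u w e : parent lt u w -> src e = u ->
  exists2 a, src a = w & lt a e.
Proof.
case=> -[wu [e0 e0u sp]] _ eu.
have [lin _ _ U3 _] := upl; have [irr _ tot] := lin.
have [] := U3 _ _ sp e; first by rewrite eu e0u.
move=> a [_ [aw _ ea _]]; exists a => //.
have /tot : a != e by apply/eqP => ae; case: wu; rewrite -aw ae.
by rewrite (negPf ea) orbF.
Qed.

Lemma before_in x u : x <> i u ->
  (forall e, src e = val u -> ltH x (emb_e f e)) -> ltH x (i u).
Proof.
case: (cext_i can) => _ _ _ H4 _ /eqP ne /H4.
by have [_ _ tot] := cext_lin can; case/orP: (tot _ _ ne) => // ->.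
Qed.

(** The first edge out of [w] precedes every edge out of [u], hence also [i u], which comes
    immediately before them. On the other side, some edge out of [w] is at or after an edge out of
    [u], hence after [i u]. This is the source of (E4). *)
Lemma between_parent u w : parent lt (val u) w -> exists a b,
  [/\ src a = w, src b = w, ltH (emb_e f a) (i u) & ltH (i u) (emb_e f b)].
Proof.
move=> par; have [lin _ _ U3 _] := upl.
have [rk [_ ltE]] := linear_rank lin.
have [rkH [_ ltHE]] := linear_rank (cext_lin can).
have [[_ [e eu [a [b [aw bw ea be]]]]] _] := par.
have [m /eqP mw mP] := lt_min lin (P := fun x => src x == w) (introT eqP aw).
exists m, b; split=> //.
  apply: before_in; first exact: emb_neq_in.
  move=> e' e'u; rewrite (cext_mono can).
  have [a' /eqP a'w] := parent_below par e'u.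
  by have := mP _ a'w; rewrite !ltE; lia.
have [_ _ H3 _ _] := cext_i can; have := H3 _ _ eu.
by have := cext_mono can b e; rewrite !ltHE !ltE in be *; lia.
Qed.

Lemma into_parent x u w : x <> i u -> parent lt (val u) w ->
  (forall a, src a = w -> ltH x (emb_e f a)) -> ltH x (i u).
Proof.
move=> ne par xw; apply: before_in => // e eu.
have [_ trans _] := cext_lin can.
have [a aw] := parent_below par eu; rewrite -(cext_mono can).
by apply: trans; apply: xw.
Qed.

Lemma consecutive_emb_in e u : consecutive (emb_e f e) (i u) -> ltH (emb_e f e) (i u).
Proof.
have [_ par _ _ _] := cext_i can; have [_ U1 _ _ _] := upl.
rewrite /consecutive /= emb_tgt eq_sym => /eqP/par pu.
apply: into_parent pu _; first exact: emb_neq_in.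
by move=> a aw; rewrite (cext_mono can) U1 // /consecutive /= aw.
Qed.

End Canonical.

Section CanonicalOrder.
Variables (G H : digraph) (ltH : rel (edge H)) (lt : rel (edge G)).
Variables (f : embedding G H).
Variables (i : source_of G -> edge H) (o : source_of (opg G) -> edge H).
Hypothesis upl : upward_planar_edgewise lt.
Hypothesis can : canonical_extension ltH lt f i o.

Let opl := upward_planar_edgewise_op upl.
Let opcan := canonical_op can.

Lemma consecutive_out_emb e w : consecutive (o w) (emb_e f e) -> ltH (o w) (emb_e f e).
Proof.
have := @consecutive_emb_in _ _ _ _ _ _ _ opl opcan e w.
by rewrite consecutive_op.
Qed.

Lemma src_in_image x u : tgt x = src (i u) -> exists w, src (i u) = emb_v f w.
Proof.
move=> xu; apply: contrapT => no.
have [_ _ _ _ H5] := cext_i can; have [|] := H5 u _ x => //.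
by move=> w E; apply: no; exists w.
Qed.

(** The vertex where [x] ends and [i u] starts has an incoming edge, so it is not a new source and
    must be the parent of [u]. All edges out of the parent come after [x], and below each edge out
    of [u] there is one of them. *)
Lemma consecutive_in x u : consecutive x (i u) -> ltH x (i u).
Proof.
have [tgt_i par H3 _ _] := cext_i can; have [irr trans _] := cext_lin can.
case: (cext_surj can x) => [[e ->]|[u' ->]|[w ->]]; first exact: (consecutive_emb_in upl can).
  rewrite /consecutive /= tgt_i eq_sym => /eqP/par pu.
  have ne : i u' <> i u.
    by move/(congr1 (@tgt H)); rewrite !tgt_i => /emb_v_inj; case: pu => -[].
  by apply: (into_parent upl can ne pu) => a; apply: H3.
move=> /eqP cw; have [v vE] := src_in_image cw.
apply: (into_parent upl can _ (iffLR (par _ _) vE)) => [|a av].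
  by move/esym; apply: (in_neq_out can).
 apply: consecutive_out_emb.
by apply/eqP; rewrite cw vE emb_src av.
Qed.

End CanonicalOrder.

Lemma canonical_consecutive (G H : digraph) (ltH : rel (edge H))
    (lt : rel (edge G)) (f : embedding G H) i o x y :
  no_isolated_vertex G -> upward_planar_edgewise lt -> canonical_extension ltH lt f i o ->
  consecutive x y -> ltH x y.
Proof.
move=> noiso upl can.
have [tgt_i _ Hi _ _] := cext_i can; have [/= src_o _ Ho _ _] := cext_o can.
case: (cext_surj can y) => [[e ->]|[u ->]|[w ->]]; last 2 first.
- exact: (consecutive_in upl can).
- case: (cext_surj can x) => [[e ->]|[u ->]|[w' ->]].
  + by rewrite /consecutive /= src_o emb_tgt => /eqP/emb_v_inj /Ho.
  (* Here [u] would be a source and a sink at once, hence isolated. *)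
  + rewrite /consecutive /= src_o tgt_i => /eqP/emb_v_inj uw.
    have [e] := source_src u noiso; rewrite uw.
    by move/(@source_tgt (opg G) w e).
  + have := @consecutive_in _ _ _ _ _ _ _ 
      (upward_planar_edgewise_op upl) (canonical_op can) (o w) w'.
    by rewrite consecutive_op.
case: (cext_surj can x) => [[e' ->]|[u ->]|[w ->]].
- have [_ U1 _ _ _] := upl; rewrite (cext_mono can) => c; apply: U1; move: c.
  by rewrite /consecutive /= emb_src emb_tgt => /eqP/emb_v_inj/eqP.
- by rewrite /consecutive /= emb_src tgt_i => /eqP/emb_v_inj/esym/Hi.
- exact: (consecutive_out_emb upl can).
Qed.

(** * Existence and uniqueness of parents *)

Lemma encloses_all (G : digraph) (lt : rel (edge G)) u w e :
  laminar lt -> encloses lt w u -> src e = u -> spans lt w e.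
Proof. by move=> U3 [_ [e0 e0u /U3 sp]] eu; apply: sp; rewrite eu. Qed.

Lemma out_min (G : digraph) (lt : rel (edge G)) (a : edge G) :
  strict_linear_order lt ->
  exists2 m, src m = src a & forall y, src y = src a -> ~~ lt y m.
Proof.
move=> lin.
have [m /eqP ma mP] := lt_min lin (P := fun x => src x == src a) (eqxx _).
by exists m => // y /eqP/mP.
Qed.

(** Among the vertices enclosing [u], the parent is the one whose first outgoing edge [m] is latest.
    For any other enclosing [w'], the edge [m] comes after the first edge out of [w'] and before an
    edge out of [w'] beyond [u], so [w'] spans [m] and laminarity applies. *)
Lemma parent_exists (G : digraph) (lt : rel (edge G)) u w :
  strict_linear_order lt -> laminar lt ->
  encloses lt w u -> exists w', parent lt u w'.
Proof.
move=> lin U3; have [rk [_ ltE]] := linear_rank lin.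
pose P m := `[< encloses lt (src m) u /\ forall y, src y = src m -> ~~ lt y m >].
have least w' : encloses lt w' u -> exists2 m, src m = w' & P m.
  move=> enc; have [_ [_ _ [a [_ [aw _ _ _]]]]] := enc.
  have [m ma mP] := out_min a lin; exists m; first by rewrite ma.
  by apply/asboolP; split; rewrite ma // aw.
case/least=> m0 _ Pm0.
have [m /asboolP[enc mP] mmax] := lt_min (oplt_linear lin) Pm0.
exists (src m); split=> // w' enc'; apply: (U3 w' m).
have [_ [e eu [_ [b [_ bw _ be]]]]] := enc'.
have [a [_ [am _ ea _]]] := encloses_all U3 enc eu.
have [m' m'w /mmax] := least _ enc'; have := mP _ am.
rewrite /oplt !ltE in be ea *; move=> ma mm'.
by exists m', b; rewrite !ltE; split=> //; lia.
Qed.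

(** Two parents are nested in each other, so their first outgoing edges coincide. *)
Lemma parent_unique (G : digraph) (lt : rel (edge G)) u w w' :
  strict_linear_order lt -> parent lt u w -> parent lt u w' -> w = w'.
Proof.
move=> lin [enc min] [enc' min']; have [rk [rkI ltE]] := linear_rank lin.
have [_ [_ _ [a [_ [aw _ _ _]]]]] := enc; have [_ [_ _ [b [_ [bw _ _ _]]]]] := enc'.
have [m ma mP] := out_min a lin; have [n nb nP] := out_min b lin.
have [c [_ [cw _ mc _]]] := min _ enc' m (etrans ma aw).
have [d [_ [dw _ nd _]]] := min' _ enc n (etrans nb bw).
have := nP c; have := mP d; rewrite cw dw aw bw => /(_ erefl) dm /(_ erefl) cn.
rewrite !ltE in mc nd dm cn; suff mn : m = n by rewrite -aw -ma mn nb bw.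
by apply: rkI; lia.
Qed.

(** * The canonical extension is planar *)

Section CanonicalPlanar.
Variables (G H : digraph) (ltH : rel (edge H)) (lt : rel (edge G)).
Variables (f : embedding G H).
Variables (i : source_of G -> edge H) (o : source_of (opg G) -> edge H).
Hypothesis upl : upward_planar_edgewise lt.
Hypothesis can : canonical_extension ltH lt f i o.

Lemma after_in y u : ltH (i u) y -> exists2 e, src e = val u & ~~ ltH y (emb_e f e).
Proof.
have [_ _ _ H4 _] := cext_i can => iy; apply: contrapT => no.
suff : ~~ ltH (i u) y by rewrite iy.
by apply: H4 => e eu; apply: contrapT => /negP ye; apply: no; exists e.
Qed.

(** If [i u] fell into such a gap, then so would the edge out of [u] that follows it, against
    [no_gap] for [lt]. That edge does not itself start at the vertex of the gap, which has an
    incoming edge while [u] has none. *)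
Lemma no_gap_in a0 b0 u : tgt a0 = src b0 ->
  (forall a, tgt a = src b0 -> ltH (emb_e f a) (i u)) ->
  (forall b, src b = src b0 -> ltH (i u) (emb_e f b)) -> False.
Proof.
move=> ab Ha Hb; have [lin _ U2 _ _] := upl.
have [rk [rkI ltE]] := linear_rank lin.
have [rkH [_ ltHE]] := linear_rank (cext_lin can).
have mono x y : (rkH (emb_e f x) < rkH (emb_e f y)) = (rk x < rk y).
  by rewrite -ltHE -ltE (cext_mono can).
have [b bb0 bmin] := out_min b0 lin.
have [e eu be] := after_in (Hb _ bb0).
have [_ _ H3 _ _] := cext_i can; have ue := H3 _ _ eu.
have a0u := Ha _ ab.
have ne : rk e <> rk b.
  by move/rkI => E; apply: (@source_tgt _ u a0); rewrite ab -bb0 -E.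
case: (U2 a0 b e); rewrite ?ltE.
- by rewrite bb0.
- by rewrite !ltHE in a0u ue; rewrite -mono; lia.
- by rewrite !ltHE mono in be; lia.
- case=> c; rewrite ab => /Ha cu ce.
  by rewrite ltE -mono in ce; rewrite !ltHE in cu ue; lia.
- case=> c; rewrite bb0 => /bmin; rewrite !ltE.
  by rewrite !ltHE mono in be; lia.
Qed.

Lemma tgt_emb a v : tgt a = emb_v f v ->
  (exists e, tgt e = v) \/ exists2 u, a = i u & val u = v.
Proof.
have [tgt_i _ _ _ _] := cext_i can; have [_ par _ _ _] := cext_o can.
case: (cext_surj can a) => [[e ->]|[u ->]|[w ->]].
- by rewrite emb_tgt => /emb_v_inj; left; exists e.
- by rewrite tgt_i => /emb_v_inj; right; exists u.
- by case/(par w v)=> -[_ [_ _ [e [_ [ev _ _ _]]]]] _; left; exists e.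
Qed.

End CanonicalPlanar.

Section CanonicalPlanar2.
Variables (G H : digraph) (ltH : rel (edge H)) (lt : rel (edge G)).
Variables (f : embedding G H).
Variables (i : source_of G -> edge H) (o : source_of (opg G) -> edge H).
Hypothesis upl : upward_planar_edgewise lt.
Hypothesis can : canonical_extension ltH lt f i o.

Let opl := upward_planar_edgewise_op upl.
Let opcan := canonical_op can.

(** A vertex with edges on both sides belongs to [G]. At a source, nothing fits between [i u] and
    all the edges out of [u], and dually at a sink. At any other vertex a gap would be bounded by
    edges of [G]; [no_gap] for [lt] keeps edges of [G] out of it and [no_gap_in] keeps new edges
    out. *)
Lemma canonical_no_gap : no_gap ltH.
Proof.
move=> a b x ab ax xb; apply: contrapT => no.
have Ha c : tgt c = tgt a -> ltH c x.
  by move=> ca; apply: contrapT => /negP cx; apply: no; left; exists c.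
have Hb c : src c = src b -> ltH x c.
  by move=> cb; apply: contrapT => /negP cx; apply: no; right; exists c.
have [v bv] : exists v, src b = emb_v f v.
  have [/= src_o _ _ _ _] := cext_o can.
  case: (cext_surj can b) => [[e ->]|[u E]|[w ->]].
  - by rewrite emb_src; exists (src e).
  - by rewrite E in ab *; apply: src_in_image can _ _ ab.
  - by exists (val w).
case: (tgt_emb can (etrans ab bv)) => [[a0 a0v]|[u au uv]]; last first.
  have [e eu] := after_in can (iffRL (rwP idP) (eq_ind a (ltH^~ x) ax _ au)).
  by rewrite Hb // emb_src eu uv bv.
case: (tgt_emb opcan bv) => [[b0 /= b0v]|[w bw wv]]; last first.
  have [e /= eu] := after_in opcan (eq_ind b (ltH x) xb _ bw).
  by rewrite /oplt Ha // emb_tgt eu wv ab bv.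
have Ia e : tgt e = v -> ltH (emb_e f e) x.
  by move=> ev; apply: Ha; rewrite emb_tgt ev ab bv.
have Ib e : src e = v -> ltH x (emb_e f e).
  by move=> ev; apply: Hb; rewrite emb_src ev bv.
case: (cext_surj can x) => [[e E]|[u E]|[w E]]; rewrite E in Ia Ib.
- have [_ _ U2 _ _] := upl; case: (U2 a0 b0 e); rewrite -?(cext_mono can).
  + by rewrite a0v b0v.
  + exact: Ia.
  + exact: Ib.
  + by case=> c; rewrite -(cext_mono can) a0v => /Ia ->.
  + by case=> c; rewrite -(cext_mono can) b0v => /Ib ->.
- apply: (@no_gap_in _ _ _ _ _ _ _ upl can a0 b0 u); rewrite ?b0v //.
- by apply: (@no_gap_in _ _ _ _ _ _ _ opl opcan b0 a0 w) => /=; rewrite ?a0v.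
Qed.

Lemma nested_below v w a e : src a = v -> nested lt w v -> src e = w -> w <> v ->
  (forall y, src y = v -> ~~ lt y a) -> lt a e.
Proof.
have [lin _ _ _ _] := upl; have [rk [rkI ltE]] := linear_rank lin.
move=> av nst ew ne amin; have [c [_ [cv _ ec _]]] := nst _ ew.
have := amin _ cv; have : rk a <> rk e by move/rkI => E; apply: ne; rewrite -av -ew E.
by rewrite !ltE in ec *; lia.
Qed.

(* By induction on x: unless x starts at v, some edge earlier than x, still not
   below the first edge out of v, ends where x starts; when x is a new edge into
   a source, its parent is nested in v. *)
Lemma spans_reach v x a b : src a = v -> src b = v ->
  ~~ ltH x (emb_e f a) -> ~~ ltH (emb_e f b) x ->
  exists2 c, src c = emb_v f v & connect (@consecutive H) c x.
Proof.
have [lin U1 U2 U3 _] := upl.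
have [rk [rkI ltE]] := linear_rank lin.
have [rkH [rkHI ltHE]] := linear_rank (cext_lin can).
have mono y z : (rkH (emb_e f y) < rkH (emb_e f z)) = (rk y < rk z).
  by rewrite -ltHE -ltE (cext_mono can).
have [tgt_i par i_lt _ _] := cext_i can.
have [/= tgt_o _ o_gt _ _] := cext_o can.
move=> av bv; have [m mv mmin] := out_min a lin; rewrite av in mv mmin.
move=> + xb; have := mmin _ av; rewrite -(cext_mono can) !ltHE => am xa.
have {a av am xa} : rkH (emb_e f m) <= rkH x by lia.
have {xb} : rkH x <= rkH (emb_e f b) by rewrite ltHE in xb; lia.
have [n] := ubnP (rkH x); elim: n => // n IHn in x *; rewrite ltnS => xn xb mx.
have step y : rkH y < rkH x -> rkH (emb_e f m) <= rkH y -> consecutive y x ->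
    exists2 c, src c = emb_v f v & connect (@consecutive H) c x.
  move=> yx my cyx; have [||//|c cv cy] := IHn y; try by lia.
  by exists c => //; apply: connect_trans cy _; apply: connect1.
case: (cext_surj can x) => [[e E]|[u E]|[w E]]; rewrite {}E in xn xb mx step *.
- have [ev|ne] := pselect (src e = v).
    by exists (emb_e f e); rewrite ?emb_src ?ev.
  have sp : spans lt v e.
    by exists m, b; rewrite !ltE -!mono; split=> //; lia.
  have nst := U3 _ _ sp; have me := nested_below mv nst erefl ne mmin.
  case: (boolP (src e \in sources G)) => [su|].
    pose u : source_of G := exist _ (src e) su.
    have ue : ltH (i u) (emb_e f e) by apply: i_lt.
    apply: (step (i u)); first by rewrite -ltHE.
      suff : ltH (emb_e f m) (i u) by rewrite ltHE; lia.
      apply: (before_in can); first exact: emb_neq_in can _ _.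
      by move=> e' e'u; rewrite (cext_mono can); apply: nested_below mv nst e'u ne mmin.
    by rewrite /consecutive /= tgt_i emb_src.
  rewrite inE -lt0n => /card_gt0P[y0]; rewrite in_edgesE => /eqP y0e.
  have [y /= ye ymax] := @out_min (opg G) (oplt lt) y0 (oplt_linear lin).
  rewrite /= {}y0e {y0} in ye ymax.
  have yltx : lt y e by apply: U1; rewrite /consecutive /= ye.
  apply: (step (emb_e f y)).
  - by rewrite mono -ltE.
  (* Otherwise [m] would lie between the last edge into [src e] and [e]. Then [no_gap] would give an
     edge out of [src e] at or before [m], but the edges out of a vertex nested in [v] come after
     [m]. *)
  - rewrite leqNgt mono -ltE; apply/negP => ym.
    case: (U2 y e m) => //.
      case=> y'; rewrite ye => /ymax; rewrite /oplt !ltE in ym *; lia.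
    case=> b' b'e mb'; have := nested_below mv nst b'e ne mmin.
    by rewrite (negPf mb').
  - by rewrite /consecutive /= emb_src emb_tgt ye.
- have iub : ltH (i u) (emb_e f b).
    by rewrite ltHE ltn_neqAle xb andbT; apply/eqP => /rkHI/esym; apply: emb_neq_in can _ _.
  have [e eu be] := after_in can iub; have ue := i_lt _ _ eu.
  have me : rk m < rk e by rewrite -mono; rewrite ltHE in ue; lia.
  have enc : encloses lt v (val u).
    split.
      by move=> vu; have := i_lt u m; rewrite mv vu ltHE => /(_ erefl); lia.
    by exists e => //; exists m, b; rewrite !ltE -!mono -!ltHE; split=> //; rewrite !ltHE mono; lia.
  have [w pu] := parent_exists lin U3 enc; have iw := iffRL (par _ _) pu.
  have [wv|ne] := pselect (w = v); first by exists (i u) => //; rewrite iw wv.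
  have nst : nested lt w v by case: pu => _; apply.
  have [c [_ [cw _ cu _]]] := between_parent upl can pu.
  have [|||d dv] := IHn (emb_e f c).
  - by rewrite ltHE in cu; lia.
  - by rewrite ltHE in cu; lia.
  - by have := nested_below mv nst cw ne mmin; rewrite ltE -mono; lia.
  case/connect_last=> [E|[z dz zc]].
    by case: ne; apply: (@emb_v_inj _ _ f); rewrite -dv E emb_src cw.
  exists d => //; apply: connect_trans dz (connect1 _).
  by move: zc; rewrite /consecutive /= emb_src cw iw.
- have mow : ltH (emb_e f m) (o w).
    rewrite ltHE ltn_neqAle mx andbT; apply/eqP => /rkHI.
    exact: (@emb_neq_in _ _ _ _ _ _ _ opcan).
  have [c /= cw mc] := after_in opcan mow.
  apply: (step (emb_e f c)).
  - by rewrite -ltHE; apply: o_gt.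
  - by rewrite leqNgt -ltHE; exact: mc.
  - by rewrite /consecutive /= emb_tgt cw tgt_o.
Qed.

End CanonicalPlanar2.

Section CanonicalPlanar3.
Variables (G H : digraph) (ltH : rel (edge H)) (lt : rel (edge G)).
Variables (f : embedding G H).
Variables (i : source_of G -> edge H) (o : source_of (opg G) -> edge H).
Hypothesis upl : upward_planar_edgewise lt.
Hypothesis can : canonical_extension ltH lt f i o.

Let opcan := canonical_op can.

Lemma between_out v a : src a = emb_v f v -> v \notin sinks G ->
  exists b c, [/\ src b = v, src c = v, ~~ ltH a (emb_e f b) & ~~ ltH (emb_e f c) a].
Proof.
have [_ par _ _ _] := cext_i can; have [irr trans _] := cext_lin can.
case: (cext_surj can a) => [[e ->]|[u ->]|[w ->]].
- by rewrite emb_src => /emb_v_inj ev _; exists e, e; rewrite irr.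
- case/(par u v)/(between_parent upl can)=> b [c [bv cv bu uc]] _.
  by exists b, c; split=> //; apply/negP => /trans; [move=> /(_ _ bu)|move=> /(_ _ uc)];
    rewrite irr.
- have [/= -> _ _ _ _] := cext_o can; move/emb_v_inj => <-.
  by rewrite (valP w).
Qed.

(** A sink of [G] and a vertex outside [G] have at most one outgoing edge, so there [a], [b] and [x]
    coincide. Elsewhere [between_out] widens the bounds to edges of [G] and [spans_reach]
    applies. *)
Lemma reach_from a b x : src a = src b -> ~~ ltH x a -> ~~ ltH b x ->
  exists2 c, src c = src a & connect (@consecutive H) c x.
Proof.
have [rkH [rkHI ltHE]] := linear_rank (cext_lin can).
move=> ab xa bx; have [E|ne] := pselect (a = b).
  exists a => //; suff -> : x = a by [].
  by apply: rkHI; rewrite -E !ltHE in xa bx; lia.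
case: (pselect (exists v, src a = emb_v f v)) => [[v av]|no].
  have [vs|nvs] := boolP (v \in sinks G).
    have uniq y : src y = emb_v f v -> y = o (exist _ v vs).
      have := @tgt_emb _ _ _ _ _ _ _ opcan y v; rewrite /= => H0 /H0[[e ev]|[w -> wv]].
        by case: (@source_tgt (opg G) (exist _ v vs) e).
      by congr o; apply: val_inj.
    by case: ne; rewrite (uniq a) // (uniq b) // -ab.
  have [a1 [_ [a1v _ a1a _]]] := between_out av nvs.
  have [_ [b1 [_ b1v _ b1b]]] := between_out (etrans (esym ab) av) nvs.
  rewrite av; apply: (spans_reach upl can a1v b1v); rewrite !ltHE in xa bx a1a b1b *; lia.
case: ne; case: (cext_surj can a) => [[e E]|[u E]|[w E]].
- by case: no; exists (src e); rewrite E emb_src.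
- have [_ _ _ _ H5] := cext_i can; rewrite E; apply/esym.
  have [w wE|_] := H5 u _ b; first by apply: no; exists w; rewrite E.
  by apply; rewrite -ab E.
- have [/= src_o _ _ _ _] := cext_o can.
  by case: no; exists (val w); rewrite E src_o.
Qed.

End CanonicalPlanar3.

Lemma canonical_planar (G H : digraph) (ltH : rel (edge H))
    (lt : rel (edge G)) (f : embedding G H) i o :
  no_isolated_vertex G -> upward_planar_edgewise lt -> canonical_extension ltH lt f i o ->
  planar_order ltH.
Proof.
move=> noiso upl can; have lin := cext_lin can; have [irr trans _] := lin.
have asym x y : ltH x y -> ~~ ltH y x by move=> xy; apply/negP => /(trans _ _ _ xy); rewrite irr.
have c_lt x y := @canonical_consecutive _ _ _ _ _ _ _ x y noiso upl can.
split=> //.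
  move=> x y /andP[ne /connectP[p xp E]]; rewrite {}E in ne *.
  case: p xp ne => [|z p] xp; first by rewrite eqxx.
  have /allP H0 := order_path_min trans (sub_path c_lt xp); move=> _; apply: H0.
  by rewrite /= mem_last.
have ne x y : ltH x y -> x != y by move=> xy; apply/eqP => E; rewrite E irr in xy.
move=> x y z xy yz /andP[_ xz]; rewrite /reaches /= !ne //=.
case: (connect_jump lin xz xy yz) => [[-> ]|[p [q [xp pq qz py yq]]]]; first by left.
(* The path from x to z jumps over y at a vertex, and by [no_gap] y lies
   between two edges into, or two edges out of, that vertex. *)
have pq' : tgt p = src q by apply/eqP.
have := canonical_no_gap upl can pq' py yq.
case=> -[c cE cy].
- have := @reach_from _ _ _ _ _ _ _ (upward_planar_edgewise_op upl) (canonical_op can) c p y.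
  case=> //; first exact: asym.
  move=> d /= dE; rewrite connect_op => yd; right.
  apply: connect_trans yd _; apply: connect_trans (connect1 _) qz.
  by rewrite /consecutive /= dE cE.
- have := @reach_from _ _ _ _ _ _ _ upl can c q y cE cy (asym _ _ yq).
  case=> d dE dy; left.
  apply: connect_trans xp _; apply: connect_trans (connect1 _) dy.
  by rewrite /consecutive /= dE cE.
Qed.

(** * CPP-extensions are canonical *)

Section PlanarLaminar.
Variables (H : digraph) (lt : rel (edge H)).
Hypothesis proc : processive H.
Hypothesis plan : planar_order lt.

Lemma planar_consecutive x y : consecutive x y -> lt x y.
Proof.
by have [_ P1 _] := plan => /(acyclic_consecutive proc.1)/P1.
Qed.

Lemma source_out_unique v x y :
  v \in sources H -> src x = v -> src y = v -> x = y.
Proof.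
move=> vs xv yv; have := proc.2 v; rewrite inE vs => /(_ isT).
move: vs; rewrite inE /degree => /eqP -> /eqP/cards1P[z /setP zE].
by have := zE x; have := zE y; rewrite !inE xv yv eqxx => /esym/eqP -> /esym/eqP ->.
Qed.

(** When [w] is not the source of [x], (P2) yields a path from [w] to [x], entering [src x] by an
    edge [z]. If an edge [y] out of [src x] lay outside the span, then [a] or [b] would separate [z]
    from an edge out of [src x]. By (P2) either [z] would lead back to [w], closing a cycle, or some
    edge into [src x] would come after an edge out of it. *)
Lemma planar_laminar : laminar lt.
Proof.
have [lin P1 P2] := plan; have [rk [rkI ltE]] := linear_rank lin.
have le x y : connect (@consecutive H) x y -> rk x <= rk y.
  by move/(connect_le lin P1); rewrite ltE -leqNgt.
have c_lt x y : consecutive x y -> rk x < rk y.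
  by rewrite -ltE; apply: planar_consecutive.
have reach x y : reaches x y -> (exists2 z, consecutive x z & connect (@consecutive H) z y) /\
    exists2 z, connect (@consecutive H) x z & consecutive z y.
  case/andP=> /eqP ne xy; split; first by case: (connect_first xy).
  by case: (connect_last xy).
move=> w x [a [b [aw bw xa bx]]] y yu.
have [uw|ne] := pselect (src x = w).
  by exists y, y; rewrite yu uw !ltE ltnn.
have neq v z : src v = w -> src z = src x -> rk v <> rk z.
  by move=> vw zx /rkI E; apply: ne; rewrite -zx -E.
have ax : rk a < rk x by have := neq a x aw erefl; rewrite !ltE in xa; lia.
have xb : rk x < rk b by have := neq b x bw erefl; rewrite !ltE in bx; lia.
(* A source has degree one, which would make [a] and [b] equal. *)
have [d dw] : exists d, tgt d = w.
  apply: contrapT => no; suff ab : a = b by rewrite ab in ax; lia.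
  apply: (source_out_unique _ aw bw); rewrite inE cards_eq0.
  apply/negP => /negP/set0Pn[d]; rewrite in_edgesE => /eqP dw.
  by apply: no; exists d.
have I_lt_O e g : tgt e = src g -> rk e < rk g by move/eqP/c_lt.
have da := I_lt_O d a; rewrite dw aw in da; have {}da := da erefl.
have nxb : ~ reaches x b.
  case/reach=> _ [z /le xz /eqP zb].
  by have := I_lt_O z a; rewrite zb aw bw => /(_ erefl); lia.
(* (P2) applies to [d], [x], [b]: a path from [x] to [b] would enter [w] after [a], so the path goes
   from [d] to [x] and leaves [w] by some edge [o]. *)
have [o [ow ox]] : exists o, src o = w /\ connect (@consecutive H) o x.
  case: (P2 d x b); rewrite ?ltE //; first by lia.
    by apply: (acyclic_consecutive proc.1); rewrite /consecutive /= dw bw.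
  by case/reach=> -[o /eqP]; rewrite dw => ow ? _; exists o.
have [z oz zx] : exists2 z, connect (@consecutive H) o z & tgt z = src x.
  case: (connect_last ox) => [E|[z oz /eqP zx]]; last by exists z.
  by case: ne; rewrite -E.
have back e : tgt e = w -> ~ connect (@consecutive H) z e.
  move=> ew /le ze; have := I_lt_O e o; rewrite ew ow => /(_ erefl).
  by have := le _ _ oz; lia.
have back' v : src v = w -> ~ reaches z v.
  by move=> vw /reach[_ [e ze /eqP]]; rewrite vw => /back/(_ ze).
have zy : rk z < rk y by apply: I_lt_O; rewrite zx yu.
have reach_in v g : src v = w -> src g = src x -> reaches v g ->
    exists2 z', tgt z' = src x & rk v <= rk z'.
  by move=> vw gx /reach[_ [z' /le ? /eqP]]; rewrite gx; exists z'.
exists a, b; rewrite !ltE; split=> //; apply/negP.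
  move=> ya; case: (P2 z a x); rewrite ?ltE //; try lia.
  - by apply: (acyclic_consecutive proc.1); apply/eqP.
  - exact: back'.
  - case/(reach_in _ _ aw erefl)=> z' z'x.
    by have := I_lt_O z' y; rewrite z'x yu => /(_ erefl); lia.
move=> yb; case: (P2 z b y); rewrite ?ltE //; first by have := I_lt_O z x zx; lia.
- by apply: (acyclic_consecutive proc.1); apply/eqP; rewrite zx.
- exact: back'.
- case/(reach_in _ _ bw yu)=> z' z'x.
  by have := I_lt_O z' x z'x; lia.
Qed.

End PlanarLaminar.

(** * Reversal and restriction of CPP-extensions *)

Definition op_pop (P : pop_graph) : pop_graph :=
  @PopGraph (opg P) (oplt (@pop_lt P)) (processive_op (pop_processive P))
    (planar_op (pop_planar P)).

Lemma op_cpp_vertices (G : digraph) (X : cpp_extension G) :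
  emb_v (op_emb (cpp_emb X)) @: [set: vertex (opg G)] =
  ~: (sources (op_pop (cpp_pop X)) :|: sinks (op_pop (cpp_pop X))).
Proof. by rewrite setUC; apply: cpp_vertices. Qed.

Lemma op_cpp_card_edges (G : digraph) (X : cpp_extension G) :
  #|edge (op_pop (cpp_pop X))| = #|edge (opg G)| + #|sources (opg G)| + #|sinks (opg G)|.
Proof. by rewrite addnAC; apply: cpp_card_edges. Qed.

Lemma op_cpp_source_sink (G : digraph) (X : cpp_extension G) (v w : vertex (opg G)) :
  v \in sources (opg G) -> w \in sinks (opg G) ->
  in_edges (emb_v (op_emb (cpp_emb X)) v) :&:
    out_edges (emb_v (op_emb (cpp_emb X)) w) = set0.
Proof. by move=> vs ws; rewrite setIC; apply: cpp_source_sink. Qed.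

Lemma op_cpp_new_edges (G : digraph) (X : cpp_extension G)
    (e : edge (op_pop (cpp_pop X))) :
  e \notin emb_e (op_emb (cpp_emb X)) @: [set: edge (opg G)]
       :|: (input_edges (op_pop (cpp_pop X)) :|: output_edges (op_pop (cpp_pop X))) ->
  strictly_inside (@pop_lt (op_pop (cpp_pop X))) (out_edges (src e)) e \/
  strictly_inside (@pop_lt (op_pop (cpp_pop X))) (in_edges (tgt e)) e.
Proof.
have [lin _ _] := pop_planar (cpp_pop X).
rewrite [input_edges _ :|: _]setUC => /cpp_new_edges[];
  move=> /(strictly_insideP lin) [a [b [aX bX ae eb]]]; [right|left];
  by apply/(strictly_insideP (oplt_linear lin)); exists b, a.
Qed.

Definition op_cpp (G : digraph) (X : cpp_extension G) : cpp_extension (opg G) :=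
  @CppExtension (opg G) (op_pop (cpp_pop X)) (op_emb (cpp_emb X))
    (op_cpp_vertices X) (op_cpp_card_edges X)
    (@op_cpp_source_sink G X) (@op_cpp_new_edges G X).

Definition restriction (G : digraph) (X : cpp_extension G) : rel (edge G) :=
  fun x y => pop_lt (emb_e (cpp_emb X) x) (emb_e (cpp_emb X) y).

Lemma cpp_internal (G : digraph) (X : cpp_extension G) v :
  emb_v (cpp_emb X) v \notin sources (cpp_pop X).
Proof.
have /setP/(_ (emb_v (cpp_emb X) v)) := cpp_vertices X.
by rewrite imset_f ?inE // => /esym/norP[].
Qed.

Lemma cpp_in_edge (G : digraph) (X : cpp_extension G) :
  exists i : source_of G -> edge (cpp_pop X),
    forall u, tgt (i u) = emb_v (cpp_emb X) (val u).
Proof.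
have ex (u : source_of G) : exists e, tgt e = emb_v (cpp_emb X) (val u).
  have := cpp_internal X (val u); rewrite inE -lt0n => /card_gt0P[e].
  by rewrite in_edgesE => /eqP ?; exists e.
by have [i iP] := choice ex; exists i.
Qed.

(** * New edges of a CPP-extension *)

Section CppStructure.
Variables (G : digraph) (X : cpp_extension G).
Variables (i : source_of G -> edge (cpp_pop X)).
Variables (o : source_of (opg G) -> edge (cpp_pop X)).
Hypothesis tgt_i : forall u, tgt (i u) = emb_v (cpp_emb X) (val u).
Hypothesis src_o : forall w, src (o w) = emb_v (cpp_emb X) (val w).
Local Notation f := (cpp_emb X).

(** The listed edges are pairwise distinct, those into sources differing from those out of sinks by
    (E3), and (E2) says that there are no others. *)
Lemma cpp_surj x : [\/ exists e, x = emb_e f e, exists u, x = i u | exists w, x = o w].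
Proof.
have io u w : i u <> o w.
  move=> E; have /setP/(_ (i u)) := cpp_source_sink X (valP u) (valP w).
  by rewrite in_setI in_edgesE out_edgesE tgt_i E src_o !eqxx inE.
have bI := all_edges_inj_of tgt_i src_o io.
have := inj_card_onto bI.
rewrite !card_sum !card_sig /= cpp_card_edges -addnA.
have -> : #|[pred x in sources G]| = #|sources G| by apply: eq_card.
have -> : #|[pred x in sources (opg G)]| = #|sinks G| by apply: eq_card.
move=> /(_ (leqnn _) x)/codomP[[e|[u|w]] ->]; first by apply: Or31; exists e.
  by apply: Or32; exists u.
by apply: Or33; exists w.
Qed.

End CppStructure.

Section CppOut.
Variables (G : digraph) (X : cpp_extension G).
Variables (i : source_of G -> edge (cpp_pop X)).
Variables (o : source_of (opg G) -> edge (cpp_pop X)).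
Hypothesis tgt_i : forall u, tgt (i u) = emb_v (cpp_emb X) (val u).
Hypothesis src_o : forall w, src (o w) = emb_v (cpp_emb X) (val w).
Local Notation f := (cpp_emb X).
Let lin : strict_linear_order (@pop_lt (cpp_pop X)).
Proof. by case: (pop_planar (cpp_pop X)). Qed.

Lemma cpp_in_unique u x : tgt x = emb_v f (val u) -> x = i u.
Proof.
case: (cpp_surj tgt_i src_o x) => [[e ->]|[u' ->]|[w ->]].
- by rewrite emb_tgt => /emb_v_inj/source_tgt.
- by rewrite tgt_i => /emb_v_inj/val_inj ->.
- move=> E; have /setP/(_ (o w)) := cpp_source_sink X (valP u) (valP w).
  by rewrite in_setI in_edgesE out_edgesE src_o E !eqxx inE.
Qed.

(** Both ends lie in the image of [G], so by (E1) the edge is neither an input nor an output edge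
    and (E4) applies. Its alternative at the target fails because [i u] is alone there. *)
Lemma cpp_new_inside u w : src (i u) = emb_v f w -> exists a b,
  [/\ src a = emb_v f w, src b = emb_v f w, pop_lt a (i u) & pop_lt (i u) b].
Proof.
move=> iw; have [irr _ _] := lin.
have : i u \notin emb_e f @: [set: edge G]
         :|: (input_edges (cpp_pop X) :|: output_edges (cpp_pop X)).
  rewrite !in_setU !negb_or; apply/and3P; split.
  - apply/negP => /imsetP[e _ /(congr1 (@tgt _))].
    by rewrite tgt_i emb_tgt => /emb_v_inj/esym/source_tgt.
  - by rewrite inE iw; apply: cpp_internal.
  - by rewrite inE tgt_i; apply: (cpp_internal (op_cpp X)).
case/cpp_new_edges=> /(strictly_insideP lin)[a [b []]].
  by rewrite !out_edgesE iw => /eqP ? /eqP ? ? ?; exists a, b.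
rewrite !in_edgesE tgt_i => /eqP/cpp_in_unique -> _.
by rewrite irr.
Qed.

End CppOut.

Section CppSpans.
Variables (G : digraph) (X : cpp_extension G).
Variables (i : source_of G -> edge (cpp_pop X)).
Variables (o : source_of (opg G) -> edge (cpp_pop X)).
Hypothesis tgt_i : forall u, tgt (i u) = emb_v (cpp_emb X) (val u).
Hypothesis src_o : forall w, src (o w) = emb_v (cpp_emb X) (val w).
Local Notation f := (cpp_emb X).
Let lin : strict_linear_order (@pop_lt (cpp_pop X)).
Proof. by case: (pop_planar (cpp_pop X)). Qed.

(** A new edge out of [w] lies strictly between two other edges out of [w], so the first and the
    last of all these edges belong to [G]. *)
Lemma cpp_between_out w a : src a = emb_v f w -> w \notin sinks G -> exists b c,
  [/\ src b = w, src c = w, ~~ pop_lt a (emb_e f b) & ~~ pop_lt (emb_e f c) a].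
Proof.
move=> aw ns.
have new_inside c : src c = emb_v f w ->
    (exists2 e, c = emb_e f e & src e = w) \/
    exists a b, [/\ src a = emb_v f w, src b = emb_v f w, pop_lt a c & pop_lt c b].
  case: (cpp_surj tgt_i src_o c) => [[e ->]|[u ->]|[v ->]].
  - by rewrite emb_src => /emb_v_inj ew; left; exists e.
  - by move/(cpp_new_inside tgt_i src_o); right.
  - by rewrite src_o => /emb_v_inj vw; rewrite -vw (valP v) in ns.
have [m mw mP] := out_min a lin.
have [n /eqP nw nP] := lt_min (oplt_linear lin) (P := fun x => src x == src a) (eqxx _).
have am := mP _ erefl; have an := nP _ (eqxx _).
case: (new_inside m (etrans mw aw)) => [[b mb bw]|[c [_ [cw _ cm _]]]]; last first.
  by move: (mP c); rewrite cw cm => /(_ (esym aw)).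
case: (new_inside n (etrans nw aw)) => [[b' nb bw']|[_ [c [_ cw _ nc]]]]; last first.
  by move: (nP c); rewrite /oplt cw nc => /(_ (introT eqP (esym aw))).
by exists b, b'; rewrite -mb -nb.
Qed.

Lemma cpp_spans w c : w \notin sinks G ->
  spans (@pop_lt (cpp_pop X)) (emb_v f w) (emb_e f c) -> spans (restriction X) w c.
Proof.
have [rk [rkI ltE]] := linear_rank lin.
move=> ns [a [b [aw bw ca bc]]].
have [a' [_ [aw' _ aa _]]] := cpp_between_out aw ns.
have [_ [b' [_ bw' _ bb]]] := cpp_between_out bw ns.
by exists a', b'; rewrite /restriction !ltE in ca bc aa bb *; split=> //; lia.
Qed.

Lemma not_sink (H : digraph) (e : edge H) : src e \notin sinks H.
Proof. by rewrite inE -lt0n; apply/card_gt0P; exists e; rewrite out_edgesE. Qed.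

Lemma cpp_laminar : laminar (restriction X).
Proof.
move=> w e [a [b [aw bw ea be]]] c ce.
apply: cpp_spans; first by rewrite -aw not_sink.
have lamX := planar_laminar (pop_processive (cpp_pop X)) (pop_planar (cpp_pop X)).
apply: (lamX _ (emb_e f e)); last by rewrite !emb_src ce.
by exists (emb_e f a), (emb_e f b); rewrite !emb_src aw bw.
Qed.

End CppSpans.

Section Cpp.
Variables (G : digraph) (X : cpp_extension G).
Variables (i : source_of G -> edge (cpp_pop X)).
Variables (o : source_of (opg G) -> edge (cpp_pop X)).
Hypothesis noiso : no_isolated_vertex G.
Hypothesis tgt_i : forall u, tgt (i u) = emb_v (cpp_emb X) (val u).
Hypothesis src_o : forall w, src (o w) = emb_v (cpp_emb X) (val w).
Local Notation f := (cpp_emb X).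
Let lin : strict_linear_order (@pop_lt (cpp_pop X)).
Proof. by case: (pop_planar (cpp_pop X)). Qed.

Lemma restriction_linear : strict_linear_order (restriction X).
Proof.
have [irr trans tot] := lin; split=> [x|y x z|x y ne].
- exact: irr.
- exact: trans.
- by apply: tot; apply: contra_neq ne => /emb_e_inj.
Qed.

Lemma emb_consecutive x y : consecutive x y -> consecutive (emb_e f x) (emb_e f y).
Proof. by rewrite /consecutive /= emb_tgt emb_src => /eqP ->. Qed.

(** For [no_gap], (P2) gives a path from [a] to [x] or from [x] to [b]. Its edge across the common
    vertex is the witness, except that it may be new; [cpp_between_out] replaces it by an edge of
    [G] at least as far out. *)
Lemma cpp_upward_planar : upward_planar_edgewise (restriction X).
Proof.
have [_ P1 P2] := pop_planar (cpp_pop X).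
have procX := pop_processive (cpp_pop X).
have [rk [rkI ltE]] := linear_rank lin.
have le x y : connect (@consecutive (cpp_pop X)) x y -> rk x <= rk y.
  by move/(connect_le lin P1); rewrite ltE -leqNgt.
split.
- exact: restriction_linear.
- by move=> x y /emb_consecutive; apply: (planar_consecutive procX (pop_planar _)).
- move=> a b x ab ax xb.
  have : reaches (emb_e f a) (emb_e f b).
    by apply: (acyclic_consecutive procX.1); apply: emb_consecutive; apply/eqP.
  case/(P2 _ _ _ ax xb)=> /andP[/eqP ne].
    case/connect_first=> [//|[z /eqP]]; rewrite emb_tgt ab => /esym zb /le zx.
    have [c [_ [cb _ zc _]]] := cpp_between_out tgt_i src_o zb (not_sink b).
    by right; exists c; rewrite // /restriction !ltE in zc *; lia.
  case/connect_last=> [//|[z /le xz /eqP]]; rewrite emb_src -ab => zb.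
  have [c [_ [/= cb _ zc _]]] :=
    @cpp_between_out _ (op_cpp X) o i src_o tgt_i (tgt a) z zb (@not_sink (opg G) a).
  move: zc; rewrite /= /oplt ltE => zc.
  by left; exists c; rewrite // /restriction ltE; lia.
- exact: cpp_laminar tgt_i src_o.
- exact: (@cpp_laminar _ (op_cpp X) o i src_o tgt_i).
Qed.

Lemma cpp_attached : attached (@pop_lt (cpp_pop X)) (restriction X) f i.
Proof.
have [_ P1 P2] := pop_planar (cpp_pop X).
have procX := pop_processive (cpp_pop X).
have c_lt := planar_consecutive procX (pop_planar (cpp_pop X)).
have [rk [rkI ltE]] := linear_rank lin.
have mono x y : restriction X x y = (rk (emb_e f x) < rk (emb_e f y)).
  by rewrite /restriction ltE.
have le x y : connect (@consecutive (cpp_pop X)) x y -> rk x <= rk y.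
  by move/(connect_le lin P1); rewrite ltE -leqNgt.
have H3 u e : src e = val u -> pop_lt (i u) (emb_e f e).
  by move=> eu; apply: c_lt; rewrite /consecutive /= tgt_i emb_src eu.
(* An edge strictly between [i u] and all edges out of [u] would, by (P2), either come after some
   edge out of [u] or precede an edge into [u], and the only such edge is [i u]. *)
have H4 u y : (forall e, src e = val u -> pop_lt y (emb_e f e)) -> ~~ pop_lt (i u) y.
  move=> yu; apply/negP => uy; have [e eu] := source_src u noiso.
  have : reaches (i u) (emb_e f e).
    by apply: (acyclic_consecutive procX.1); rewrite /consecutive /= tgt_i emb_src eu.
  case/(P2 _ _ _ uy (yu _ eu))=> /andP[/eqP ne].
    case/connect_first=> [//|[z /eqP]]; rewrite tgt_i => /esym zu /le zy.
    have [|c [_ [cu _ zc _]]] := cpp_between_out tgt_i src_o zu.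
      by rewrite -eu not_sink.
    by have := yu _ cu; rewrite !ltE in zc *; lia.
  case/connect_last=> [//|[z /le yz /eqP]]; rewrite emb_src eu.
  by move/(cpp_in_unique tgt_i src_o) => E; rewrite ltE -E in uy; lia.
have after u y : pop_lt (i u) y -> exists2 e, src e = val u & ~~ pop_lt y (emb_e f e).
  move=> uy; apply: contrapT => no; suff : ~~ pop_lt (i u) y by rewrite uy.
  by apply: H4 => e eu; apply: contrapT => /negP ye; apply: no; exists e.
have linG := restriction_linear.
have lam := cpp_laminar tgt_i src_o.
have inside u w : encloses (restriction X) w (val u) -> exists a b,
    [/\ src a = w, src b = w, pop_lt (emb_e f a) (i u) & pop_lt (i u) (emb_e f b)].
  move=> enc; have [_ [e eu [a [b [aw bw _ be]]]]] := enc.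
  have [m ma mP] := out_min a linG; exists m, b; split=> //; first by rewrite ma.
    have ne : rk (emb_e f m) <> rk (i u).
      move/rkI/(congr1 (@tgt _)); rewrite emb_tgt tgt_i => /emb_v_inj.
      exact: source_tgt.
    suff : ~~ pop_lt (i u) (emb_e f m) by rewrite !ltE; lia.
    apply: H4 => e' e'u; have [c [_ [cw _ ec _]]] := encloses_all lam enc e'u.
    have {}ne : rk (emb_e f m) <> rk (emb_e f e').
      by move/rkI/emb_e_inj => E; case: enc => -[]; rewrite -aw -ma E.
    by have := mP c; rewrite cw aw !mono ltE in ec * => /(_ erefl); lia.
  by have := H3 _ _ eu; rewrite mono !ltE in be *; lia.
have to_parent u w : src (i u) = emb_v f w -> parent (restriction X) (val u) w.
  move=> iw; have [a [b [aw bw au ub]]] := cpp_new_inside tgt_i src_o iw.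
  have ns : w \notin sinks G.
    apply/negP => ws.
    have U := @cpp_in_unique _ (op_cpp X) o i src_o tgt_i (exist _ w ws).
    have E : a = b by rewrite (U a) // (U b).
    by rewrite E !ltE in au ub; lia.
  have [a' [_ [aw' _ aa _]]] := cpp_between_out tgt_i src_o aw ns.
  have [_ [b' [_ bw' _ bb]]] := cpp_between_out tgt_i src_o bw ns.
  split.
    split.
      move=> wu; have : pop_lt (i u) (i u) by apply: c_lt; rewrite /consecutive /= tgt_i iw wu.
      by rewrite ltE ltnn.
    have [|e eu be] := after u (emb_e f b'); first by rewrite !ltE in ub bb *; lia.
    have := H3 _ _ eu => ue.
    by exists e => //; exists a', b'; rewrite !mono !ltE in au aa be ue *; split=> //; lia.
  (* An enclosing [w'] spans [i u] itself, so laminarity of the extension covers every edge that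
     starts with [i u] at [w]. *)
  move=> w' /inside[c [d [cw dw cu ud]]] e ew.
  apply: (cpp_spans tgt_i src_o); first by rewrite -cw not_sink.
  have lamX := planar_laminar procX (pop_planar (cpp_pop X)).
  apply: (lamX _ (i u)); last by rewrite emb_src ew iw.
  by exists (emb_e f c), (emb_e f d); rewrite !emb_src cw dw !ltE in cu ud *; split=> //; lia.
have new_source u : (forall w, src (i u) <> emb_v f w) -> src (i u) \in sources (cpp_pop X).
  move=> no; have /setP/(_ (src (i u))) := cpp_vertices X.
  rewrite in_setC in_setU (negPf (not_sink (i u))) orbF.
  case: (_ \in sources _) => //= /imsetP[w _ /no []].
have no_in v (x : edge (cpp_pop X)) : v \in sources (cpp_pop X) -> tgt x <> v.
  by move=> vs; apply: (@source_tgt _ (exist _ v vs)).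
split=> //.
- move=> u w; split; first exact: to_parent.
  move=> par; have [a [b [aw bw au ub]]] := inside u w par.1.
  have [[v iv]|no] := pselect (exists v, src (i u) = emb_v f v).
    by rewrite iv (parent_unique linG par (to_parent _ _ iv)).
  have {no} us : src (i u) \in sources (cpp_pop X).
    by apply: new_source => v iv; apply: no; exists v.
  (* If [i u] started at a new source, it would still lie between an edge [d] into [w] and the edge
     [b] out of it. No path leads to [i u], and a path from [i u] to [b] would enter [w] no earlier
     than [i u], hence after [a]. *)
  have := cpp_internal X w; rewrite inE -lt0n => /card_gt0P[d].
  rewrite in_edgesE => /eqP dw.
  have da : pop_lt d (emb_e f a) by apply: c_lt; rewrite /consecutive /= emb_src aw dw.
  have db : reaches d (emb_e f b).
    by apply: (acyclic_consecutive procX.1); rewrite /consecutive /= emb_src bw dw.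
  have du : pop_lt d (i u) by rewrite !ltE in da au *; lia.
  case/(P2 _ _ _ du ub): db => /andP[/eqP ne] /connect_last[//|[z + /eqP]].
    by move=> _ /(no_in _ _ us).
  rewrite emb_src bw => /le uz zw.
  have za : pop_lt z (emb_e f a) by apply: c_lt; rewrite /consecutive /= emb_src aw zw.
  by rewrite !ltE in za au; lia.
- move=> u /new_source us x; split; first exact: no_in.
  by move=> xu; apply: (source_out_unique procX us xu).
Qed.

End Cpp.

Lemma cpp_canonical (G : digraph) (X : cpp_extension G) :
  no_isolated_vertex G -> upward_planar_edgewise (restriction X) /\
  exists i o, canonical_extension (@pop_lt (cpp_pop X)) (restriction X) (cpp_emb X) i o.
Proof.
move=> noiso; have [i tgt_i] := cpp_in_edge X; have [o src_o] := cpp_in_edge (op_cpp X).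
split; first exact: cpp_upward_planar tgt_i src_o.
exists i, o; split=> //.
- by case: (pop_planar (cpp_pop X)).
- exact: cpp_surj tgt_i src_o.
- exact: cpp_attached noiso tgt_i src_o.
- exact: (@cpp_attached (opg G) (op_cpp X) o i (isolated_op noiso) src_o tgt_i).
Qed.

(** * Uniqueness of the canonical extension *)

(** Both extensions are covered by the same set of names, so an isomorphism exists as soon as they
    identify the same names. *)
Lemma bijection_of_kernels (A V W : Type) (p : A -> V) (q : A -> W) :
  (forall v, exists x, p x = v) -> (forall w, exists x, q x = w) ->
  (forall x y, p x = p y <-> q x = q y) ->
  exists2 l : V -> W, bijective l & forall x, q x = l (p x).
Proof.
move=> /choice[s sK] /choice[t tK] pq; exists (q \o s) => [|x].
  by exists (p \o t) => v /=; [rewrite -[RHS]sK|rewrite -[RHS]tK]; apply/pq; rewrite ?sK ?tK.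
by apply/pq; rewrite sK.
Qed.

Section CanonicalComparison.
Variables (G H : digraph) (ltH : rel (edge H)) (lt : rel (edge G)).
Variables (f : embedding G H).
Variables (i : source_of G -> edge H) (o : source_of (opg G) -> edge H).
Hypothesis can : canonical_extension ltH lt f i o.

Lemma all_edges_inj : injective (all_edges f i o).
Proof.
have [tgt_i _ _ _ _] := cext_i can; have [src_o _ _ _ _] := cext_o can.
exact: all_edges_inj_of tgt_i src_o (in_neq_out can).
Qed.

Lemma all_edges_surj x : exists y, all_edges f i o y = x.
Proof.
case: (cext_surj can x) => [[e ->]|[u ->]|[w ->]].
- by exists (inl e).
- by exists (inr (inl u)).
- by exists (inr (inr w)).
Qed.

Lemma lt_in x u : x <> i u ->
  ltH x (i u) <-> forall e, src e = val u -> ltH x (emb_e f e).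
Proof.
move=> ne; split; last exact: before_in can _ _ ne.
have [_ trans _] := cext_lin can; have [_ _ H3 _ _] := cext_i can.
by move=> xu e /H3; apply: trans.
Qed.

Lemma src_all_edges x v : src (all_edges f i o x) = emb_v f v <->
  match x with
  | inl e => src e = v
  | inr (inl u) => parent lt (val u) v
  | inr (inr w) => val w = v
  end.
Proof.
have [_ par _ _ _] := cext_i can; have [/= src_o _ _ _ _] := cext_o can.
case: x => [e|[u|w]] /=.
- by rewrite emb_src; split=> [/emb_v_inj|->].
- exact: par.
- by rewrite src_o; split=> [/emb_v_inj|->].
Qed.

Lemma src_all_edges_eq x y :
  src (all_edges f i o x) = src (all_edges f i o y) ->
  x = y \/ exists2 v, src (all_edges f i o x) = emb_v f v
                    & src (all_edges f i o y) = emb_v f v.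
Proof.
move=> E; have [[v xv]|no] := pselect (exists v, src (all_edges f i o x) = emb_v f v).
  by right; exists v; rewrite -?E.
left; case: x => [e|[u|w]] /= in E no *.
- by case: no; exists (src e); rewrite emb_src.
- have [_ _ _ _ H5] := cext_i can.
  have [|_ /(_ (esym E))] := H5 u _ (all_edges f i o y).
    by move=> w iw; apply: no; exists w.
  by rewrite -[i u]/(all_edges f i o (inr (inl u))) => /all_edges_inj.
- have [/= src_o _ _ _ _] := cext_o can.
  by case: no; exists (val w); rewrite src_o.
Qed.

Lemma tgt_src_all_edges x y :
  tgt (all_edges f i o x) = src (all_edges f i o y) ->
  exists v, src (all_edges f i o y) = emb_v f v.
Proof.
case: y => [e|[u|w]] /=.
- by exists (src e); rewrite emb_src.
- exact: src_in_image can _ _.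
- by have [/= src_o _ _ _ _] := cext_o can; exists (val w); rewrite src_o.
Qed.

End CanonicalComparison.

Section CanonicalUnique.
Variables (G H K : digraph) (lt : rel (edge G)).
Variables (ltH : rel (edge H)) (ltK : rel (edge K)).
Variables (f : embedding G H) (g : embedding G K).
Variables (i : source_of G -> edge H) (o : source_of (opg G) -> edge H).
Variables (j : source_of G -> edge K) (p : source_of (opg G) -> edge K).
Hypothesis canH : canonical_extension ltH lt f i o.
Hypothesis canK : canonical_extension ltK lt g j p.

Let a : ext_edge G -> edge H := all_edges f i o.
Let b : ext_edge G -> edge K := all_edges g j p.
Let agree x y := ltH (a x) (a y) = ltK (b x) (b y).

Lemma agree_sym x y : agree x y -> agree y x.
Proof.
have [irrH transH totH] := cext_lin canH; have [irrK transK totK] := cext_lin canK.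
rewrite /agree; have [->//|/eqP ne] := eqVneq x y.
have neH : a y != a x by apply/eqP => /(all_edges_inj canH)/esym.
have neK : b y != b x by apply/eqP => /(all_edges_inj canK)/esym.
have flipH : ltH (a y) (a x) = ~~ ltH (a x) (a y).
  case/orP: (totH _ _ neH) => xy; rewrite xy ?(negbTE _) //=.
    by apply/esym/negP => /(transH _ _ _ xy); rewrite irrH.
  by apply/negP => /(transH _ _ _ xy); rewrite irrH.
have flipK : ltK (b y) (b x) = ~~ ltK (b x) (b y).
  case/orP: (totK _ _ neK) => xy; rewrite xy //=.
    by apply/esym/negP => /(transK _ _ _ xy); rewrite irrK.
  by apply/negP => /(transK _ _ _ xy); rewrite irrK.
by rewrite flipH flipK => ->.
Qed.

(** By [lt_in], the edges out of [u] decide in the same way in both extensions what lies below the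
    new edge into [u]. *)
Lemma agree_in x u :
  (forall e, src e = val u -> agree x (inl e)) -> agree x (inr (inl u)).
Proof.
have [irrH _ _] := cext_lin canH; have [irrK _ _] := cext_lin canK.
have [->|/eqP ne] := eqVneq x (inr (inl u)); first by rewrite /agree irrH irrK.
move=> xu; have neH : a x <> i u by move/(@all_edges_inj _ _ _ _ _ _ _ canH x (inr (inl u))).
have neK : b x <> j u by move/(@all_edges_inj _ _ _ _ _ _ _ canK x (inr (inl u))).
apply/idP/idP => [/(lt_in canH neH)|/(lt_in canK neK)] lts;
  [apply/(lt_in canK neK)|apply/(lt_in canH neH)] => e eu;
  by have := lts e eu; have := xu e eu; rewrite /agree /= => ->.
Qed.

Lemma agree_out w x :
  (forall e, tgt e = val w -> agree (inl e) x) -> agree (inr (inr w)) x.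
Proof.
have [irrH _ _] := cext_lin canH; have [irrK _ _] := cext_lin canK.
have [->|/eqP ne] := eqVneq x (inr (inr w)); first by rewrite /agree irrH irrK.
move=> xu; have neH : a x <> o w by move/(@all_edges_inj _ _ _ _ _ _ _ canH x (inr (inr w))).
have neK : b x <> p w by move/(@all_edges_inj _ _ _ _ _ _ _ canK x (inr (inr w))).
have inH := lt_in (canonical_op canH) neH; have inK := lt_in (canonical_op canK) neK.
apply/idP/idP => [/inH|/inK] lts; [apply/inK|apply/inH] => e eu;
  by have := lts e eu; have := xu e eu; rewrite /agree /oplt /= => ->.
Qed.

Lemma all_edges_agree x y : agree x y.
Proof.
have ee e e' : agree (inl e) (inl e').
  by rewrite /agree /= (cext_mono canH) (cext_mono canK).
have ue u e : agree (inr (inl u)) (inl e) by apply/agree_sym/agree_in.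
have we w e : agree (inr (inr w)) (inl e) by apply/agree_out.
have wu w u : agree (inr (inr w)) (inr (inl u)) by apply: agree_in.
case: x y => [e|[u|w]] [e'|[u'|w']] //; try exact: agree_sym.
- exact: agree_in.
- by apply: agree_out => e _; apply: agree_sym.
Qed.

Lemma src_agree x y : src (a x) = src (a y) -> src (b x) = src (b y).
Proof.
case/(src_all_edges_eq canH)=> [->//|[v /(src_all_edges canH) xv /(src_all_edges canH) yv]].
by rewrite (iffRL (src_all_edges canK x v) xv) (iffRL (src_all_edges canK y v) yv).
Qed.

End CanonicalUnique.

Definition swap_ext (G : digraph) (x : ext_edge G) : ext_edge (opg G) :=
  match x with
  | inl e => inl e
  | inr (inl u) => inr (inr u)
  | inr (inr w) => inr (inl w)
  end.

Lemma all_edges_op (G H : digraph) (f : embedding G H) i o x :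
  @all_edges (opg G) (opg H) (op_emb f) o i (swap_ext x) = all_edges f i o x.
Proof. by case: x => [e|[u|w]]. Qed.

Lemma tgt_agree (G H K : digraph) (lt : rel (edge G)) (ltH : rel (edge H))
    (ltK : rel (edge K)) (f : embedding G H) (g : embedding G K) i o j p x y :
  canonical_extension ltH lt f i o -> canonical_extension ltK lt g j p ->
  tgt (all_edges f i o x) = tgt (all_edges f i o y) ->
  tgt (all_edges g j p x) = tgt (all_edges g j p y).
Proof.
move=> canH canK; rewrite -!(all_edges_op f i o) -!(all_edges_op g j p).
exact: (src_agree (canonical_op canH) (canonical_op canK)).
Qed.

Lemma tgt_all_edges (G H : digraph) (lt : rel (edge G)) (ltH : rel (edge H))
    (f : embedding G H) i o x v : canonical_extension ltH lt f i o ->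
  tgt (all_edges f i o x) = emb_v f v <->
  match x with
  | inl e => tgt e = v
  | inr (inl u) => val u = v
  | inr (inr w) => @parent (opg G) (oplt lt) (val w) v
  end.
Proof.
move=> can; rewrite -(all_edges_op f i o).
have := src_all_edges (canonical_op can) (swap_ext x) v.
by case: x => [e|[u|w]].
Qed.

Lemma tgt_src_agree (G H K : digraph) (lt : rel (edge G)) (ltH : rel (edge H))
    (ltK : rel (edge K)) (f : embedding G H) (g : embedding G K) i o j p x y :
  canonical_extension ltH lt f i o -> canonical_extension ltK lt g j p ->
  tgt (all_edges f i o x) = src (all_edges f i o y) ->
  tgt (all_edges g j p x) = src (all_edges g j p y).
Proof.
move=> canH canK E; have [v yv] := tgt_src_all_edges canH E.
have /(tgt_all_edges x v canH)/(tgt_all_edges x v canK) -> := etrans E yv.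
by move/(src_all_edges canH)/(src_all_edges canK): yv => ->.
Qed.

Lemma processive_end (H : digraph) (v : vertex H) :
  processive H -> exists e, src e = v \/ tgt e = v.
Proof.
case=> _ deg; have [vs|] := boolP (v \in sources H).
  have := deg v; rewrite inE vs => /(_ isT); move: vs; rewrite inE /degree.
  move=> /eqP -> /eqP/cards1P[e /setP/(_ e)].
  by rewrite out_edgesE inE eqxx => /eqP; exists e; left.
rewrite inE -lt0n => /card_gt0P[e]; rewrite in_edgesE => /eqP; by exists e; right.
Qed.

Lemma cpp_iso_of_restriction (G : digraph) (X Y : cpp_extension G) :
  no_isolated_vertex G -> restriction X = restriction Y -> cpp_iso X Y.
Proof.
move=> noiso XY; have [_ [i [o canX]]] := cpp_canonical X noiso.
have [_ [j [p canY]]] := cpp_canonical Y noiso; rewrite -XY in canY.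
pose a := all_edges (cpp_emb X) i o; pose b := all_edges (cpp_emb Y) j p.
have [l1 l1_bij l1E] : exists2 l1, bijective l1 & forall x, b x = l1 (a x).
  apply: bijection_of_kernels; try exact: (all_edges_surj canX).
    exact: (all_edges_surj canY).
  by move=> x y; split=> [/(all_edges_inj canX)|/(all_edges_inj canY)] ->.
(* A vertex is named by an edge and a choice of one of its ends; in a processive graph every vertex
   has such a name. *)
pose ends (H : digraph) (c : ext_edge G -> edge H) (x : ext_edge G * bool) :=
  if x.2 then src (c x.1) else tgt (c x.1).
have ends_surj (H : digraph) (c : ext_edge G -> edge H) v :
    processive H -> (forall e, exists x, c x = e) -> exists x, ends H c x = v.
  move=> /(processive_end v)[e [ev|ev]] /(_ e)[x xe].
    by exists (x, true); rewrite /ends /= xe.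
  by exists (x, false); rewrite /ends /= xe.
have [l0 l0_bij l0E] : exists2 l0, bijective l0 & forall x, ends _ b x = l0 (ends _ a x).
  apply: bijection_of_kernels.
  - by move=> v; apply: ends_surj (pop_processive _) (all_edges_surj canX).
  - by move=> v; apply: ends_surj (pop_processive _) (all_edges_surj canY).
  - case=> x [] [y []]; rewrite /ends /=.
    + by split; [exact: (src_agree canX canY)|exact: (src_agree canY canX)].
    + split=> /esym E; apply/esym; first exact: (tgt_src_agree canX canY).
      exact: (tgt_src_agree canY canX).
    + by split; [exact: (tgt_src_agree canX canY)|exact: (tgt_src_agree canY canX)].
    + by split; [exact: (tgt_agree canX canY)|exact: (tgt_agree canY canX)].
have srcE x : src (b x) = l0 (src (a x)) := l0E (x, true).
have tgtE x : tgt (b x) = l0 (tgt (a x)) := l0E (x, false).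
exists l0, l1; split=> //.
- by move=> e; have [x <-] := all_edges_surj canX e; rewrite -l1E -srcE -tgtE.
- move=> e1 e2; have [x <-] := all_edges_surj canX e1.
  have [y <-] := all_edges_surj canX e2; rewrite -!l1E.
  exact: (all_edges_agree canX canY).
(* Every vertex of [G] is an end of an edge of [G], and [l0] is already known on ends of edges. *)
- move=> v; have := noiso v; rewrite -lt0n => /card_gt0P[e].
  rewrite in_setU in_edgesE out_edgesE => /orP[] /eqP <-.
    by rewrite -!emb_tgt; apply: (tgtE (inl e)).
  by rewrite -!emb_src; apply: (srcE (inl e)).
- by move=> e; apply: (l1E (inl e)).
Qed.

(** * Construction of the extension *)

Section Construction.
Variables (G : digraph) (lt : rel (edge G)).
Hypothesis noiso : no_isolated_vertex G.
Hypothesis upl : upward_planar_edgewise lt.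
Variables (pin : source_of G -> option (vertex G)).
Variables (pout : source_of (opg G) -> option (vertex G)).
Hypothesis pinP : forall u w, pin u = Some w <-> parent lt (val u) w.
Hypothesis poutP :
  forall w v, pout w = Some v <-> @parent (opg G) (oplt lt) (val w) v.
Variables (fst_out : source_of G -> edge G) (lst_in : source_of (opg G) -> edge G).
Hypothesis fst_outE : forall u, src (fst_out u) = val u.
Hypothesis fst_outP : forall (u : source_of G) e, src e = val u -> ~~ lt e (fst_out u).
Hypothesis lst_inE : forall w, tgt (lst_in w) = val w.
Hypothesis lst_inP : forall (w : source_of (opg G)) (e : edge G),
  tgt e = val w -> ~~ lt (lst_in w) e.
Variable rk : edge G -> nat.
Hypothesis rkI : injective rk.
Hypothesis ltE : forall x y, lt x y = (rk x < rk y).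

(** A new vertex is kept only for a source or a sink without parent. Carving the vertices out of a
    sum makes them a finite type and lets equality be checked on the untyped ends [raw_src] and
    [raw_tgt]. *)
Definition new_vertex_ok (r : vertex G + (source_of G + source_of (opg G))) :=
  match r with
  | inl _ => true
  | inr (inl u) => pin u == None
  | inr (inr w) => pout w == None
  end.

Definition ext_vertex : finType := {r | new_vertex_ok r}.

Definition raw_src (x : ext_edge G) : vertex G + (source_of G + source_of (opg G)) :=
  match x with
  | inl e => inl (src e)
  | inr (inl u) => if pin u is Some w then inl w else inr (inl u)
  | inr (inr w) => inl (val w)
  end.

Definition raw_tgt (x : ext_edge G) : vertex G + (source_of G + source_of (opg G)) :=
  match x with
  | inl e => inl (tgt e)
  | inr (inl u) => inl (val u)
  | inr (inr w) => if pout w is Some v then inl v else inr (inr w)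
  end.

Lemma raw_src_ok x : new_vertex_ok (raw_src x).
Proof. by case: x => [e|[u|w]] //=; case E: (pin u) => //=; rewrite E. Qed.

Lemma raw_tgt_ok x : new_vertex_ok (raw_tgt x).
Proof. by case: x => [e|[u|w]] //=; case E: (pout w) => //=; rewrite E. Qed.

Definition ext_graph : digraph :=
  @Digraph ext_vertex (ext_edge G)
    (fun x => exist _ (raw_src x) (raw_src_ok x))
    (fun x => exist _ (raw_tgt x) (raw_tgt_ok x)).

Definition ext_v (v : vertex G) : vertex ext_graph :=
  exist (fun r => new_vertex_ok r) (inl v) isT.

Lemma ext_v_inj : injective ext_v.
Proof. by move=> v w /(congr1 val) []. Qed.

Lemma ext_e_inj : injective (inl : edge G -> edge ext_graph).
Proof. by move=> e e' []. Qed.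

Lemma ext_src e : @src ext_graph (inl e) = ext_v (src e).
Proof. exact: val_inj. Qed.

Lemma ext_tgt e : @tgt ext_graph (inl e) = ext_v (tgt e).
Proof. exact: val_inj. Qed.

Definition ext_emb : embedding G ext_graph :=
  Embedding ext_v_inj ext_e_inj ext_src ext_tgt.

Definition ext_in (u : source_of G) : edge ext_graph := inr (inl u).
Definition ext_out (w : source_of (opg G)) : edge ext_graph := inr (inr w).

(* Multiplying ranks by 3 leaves room for one new edge on each side of an edge. *)
Definition position (x : edge ext_graph) : nat :=
  match x with
  | inl e => 3 * rk e + 1
  | inr (inl u) => 3 * rk (fst_out u)
  | inr (inr w) => 3 * rk (lst_in w) + 2
  end.

Definition ext_lt : rel (edge ext_graph) := fun x y => position x < position y.

Lemma position_inj : injective position.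
Proof.
have fI u u' : rk (fst_out u) = rk (fst_out u') -> u = u'.
  by move/rkI/(congr1 (@src G)); rewrite !fst_outE => /val_inj.
have lI w w' : rk (lst_in w) = rk (lst_in w') -> w = w'.
  by move/rkI/(congr1 (@tgt G)); rewrite !lst_inE => /val_inj.
case=> [e|[u|w]] [e'|[u'|w']] /= E; try lia.
- by congr inl; apply: rkI; lia.
- by congr (inr (inl _)); apply: fI; lia.
- by congr (inr (inr _)); apply: lI; lia.
Qed.

Lemma ext_lt_linear : strict_linear_order ext_lt.
Proof.
split=> [x|y x z|x y]; rewrite /ext_lt; first exact: ltnn.
  exact: ltn_trans.
by rewrite -(inj_eq position_inj) neq_ltn.
Qed.

Lemma ext_canonical : canonical_extension ext_lt lt ext_emb ext_in ext_out.
Proof.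
split.
- exact: ext_lt_linear.
- by move=> x y; rewrite /ext_lt ltE /=; lia.
- by case=> [e|[u|w]]; [apply: Or31; exists e|apply: Or32; exists u|apply: Or33; exists w].
- split=> [u|u w|u e eu|u y|u no x].
  + exact: val_inj.
  + rewrite -pinP; split=> [/(congr1 val) /=|E]; last by apply: val_inj; rewrite /= E.
    by case: (pin u) => // v [->].
  + by have := fst_outP eu; rewrite /ext_lt ltE /=; lia.
  (* Below [3 * rk (fst_out u) + 1] means at most [3 * rk (fst_out u)], the position of [ext_in u]
     itself. *)
  + by move/(_ _ (fst_outE u)); rewrite /ext_lt /=; lia.
  + have Eu : pin u = None.
      case E: (pin u) => [w|//]; case: (no w); apply: val_inj; by rewrite /= E.
    split=> /(congr1 val) /=; rewrite Eu.
      by case: x => [e|[u'|w]] //=; case: (pout w).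
    by case: x => [e|[u'|w]] //=; case: (pin u') => // -[->].
- split=> [w|w v|w e ew|w y|w no x].
  + exact: val_inj.
  + rewrite -poutP; split=> [/(congr1 val) /=|E]; last by apply: val_inj; rewrite /= E.
    by case: (pout w) => // v' [->].
  + by have := lst_inP ew; rewrite /oplt /ext_lt ltE /=; lia.
  + by move/(_ _ (lst_inE w)); rewrite /oplt /ext_lt /=; lia.
  + have Ew : pout w = None.
      case E: (pout w) => [v|//]; case: (no v); apply: val_inj; by rewrite /= E.
    split=> /(congr1 val) /=; rewrite Ew.
      by case: x => [e|[u|w']] //=; case: (pin u).
    by case: x => [e|[u|w']] //=; case: (pout w') => // -[->].
Qed.

Lemma ext_internal v : ext_v v \notin sources ext_graph :|: sinks ext_graph.
Proof.
rewrite in_setU negb_or; apply/andP; split; rewrite inE -lt0n; apply/card_gt0P.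
  have [vs|] := boolP (v \in sources G).
    by exists (ext_in (exist _ v vs)); rewrite in_edgesE; apply/eqP/val_inj.
  rewrite inE -lt0n => /card_gt0P[e]; rewrite in_edgesE => /eqP ev.
  by exists (inl e); rewrite in_edgesE ext_tgt ev.
have [vs|] := boolP (v \in sinks G).
  by exists (ext_out (exist _ v vs)); rewrite out_edgesE; apply/eqP/val_inj.
rewrite inE -lt0n => /card_gt0P[e]; rewrite out_edgesE => /eqP ev.
by exists (inl e); rewrite out_edgesE ext_src ev.
Qed.

Lemma ext_new_in u (H : new_vertex_ok (inr (inl u))) :
  @in_edges ext_graph (exist _ (inr (inl u)) H) = set0 /\
  @out_edges ext_graph (exist _ (inr (inl u)) H) = [set ext_in u].
Proof.
split; apply/setP => x; rewrite ?in_edgesE ?out_edgesE inE ?in_set1 -val_eqE /=.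
  by case: x => [e|[u'|w]] //=; case: (pout w).
move/eqP: (H) => /= Eu; case: x => [e|[u'|w]] //=.
case E: (pin u') => [w|]; last by [].
by apply/esym/negbTE/eqP => -[uu]; rewrite uu Eu in E.
Qed.

Lemma ext_new_out w (H : new_vertex_ok (inr (inr w))) :
  @out_edges ext_graph (exist _ (inr (inr w)) H) = set0 /\
  @in_edges ext_graph (exist _ (inr (inr w)) H) = [set ext_out w].
Proof.
split; apply/setP => x; rewrite ?in_edgesE ?out_edgesE inE ?in_set1 -val_eqE /=.
  by case: x => [e|[u|w']] //=; case: (pin u).
move/eqP: (H) => /= Ew; case: x => [e|[u|w']] //=.
case E: (pout w') => [v|]; last by [].
by apply/esym/negbTE/eqP => -[ww]; rewrite ww Ew in E.
Qed.

Lemma ext_processive : processive ext_graph.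
Proof.
split.
  apply: (acyclic_of_lt ext_lt_linear) => x y.
  exact: canonical_consecutive noiso upl ext_canonical.
case=> -[v|[u|w]] H; rewrite /degree.
- have -> : exist _ (inl v) H = ext_v v by apply: val_inj.
  by rewrite (negPf (ext_internal v)).
- by have [-> ->] := ext_new_in H; rewrite cards0 cards1.
- by have [-> ->] := ext_new_out H; rewrite cards0 cards1.
Qed.

Definition ext_pop : pop_graph :=
  PopGraph ext_processive (canonical_planar noiso upl ext_canonical).

Lemma ext_vertices :
  emb_v ext_emb @: [set: vertex G] = ~: (sources ext_pop :|: sinks ext_pop).
Proof.
apply/setP => x; rewrite in_setC; apply/imsetP/idP => [[v _ ->]|].
  exact: ext_internal.
case: x => -[v|[u|w]] H.
- by exists v => //; apply: val_inj.
- by rewrite in_setU inE (ext_new_in H).1 cards0.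
- by rewrite in_setU [_ \in sinks _]inE (ext_new_out H).1 cards0 orbT.
Qed.

Lemma ext_card_edges : #|edge ext_pop| = #|edge G| + #|sources G| + #|sinks G|.
Proof. by rewrite !card_sum !card_sig -addnA; congr (_ + (_ + _)); apply: eq_card. Qed.

Lemma ext_source_sink v w : v \in sources G -> w \in sinks G ->
  @in_edges ext_pop (emb_v ext_emb v) :&: @out_edges ext_pop (emb_v ext_emb w) = set0.
Proof.
move=> vs ws; apply/setP => x; rewrite in_setI in_edgesE out_edgesE inE.
apply/negP => /andP[/eqP/(congr1 val) /= + /eqP/(congr1 val) /=].
case: x => [e|[u|w']] /=.
- by move=> [ev] _; apply: (@source_tgt _ (exist _ v vs) e).
- case E: (pin u) => [w'|//] _ [ww]; rewrite ww in E.
  have /pinP[[_ [_ _ [a [_ [aw _ _ _]]]]] _] := E.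
  exact: (@source_tgt (opg G) (exist _ w ws) a).
- case E: (pout w') => [v'|//] [vv] _; rewrite vv in E.
  have /poutP[[_ [_ _ [a [_ [av _ _ _]]]]] _] := E.
  exact: (@source_tgt G (exist _ v vs) a).
Qed.

Lemma ext_new_edges (x : edge ext_pop) :
  x \notin emb_e ext_emb @: [set: edge G]
       :|: (input_edges ext_pop :|: output_edges ext_pop) ->
  strictly_inside ext_lt (out_edges (src x)) x \/
  strictly_inside ext_lt (in_edges (tgt x)) x.
Proof.
have lin := ext_lt_linear; rewrite !in_setU !negb_or => /and3P[xG xI xO].
case: x xG xI xO => [e|[u|w]].
- by rewrite (imset_f (emb_e ext_emb)).
- move=> _ xI _; left; apply/(strictly_insideP lin).
  case E: (pin u) => [v|]; last first.
    have H : new_vertex_ok (inr (inl u)) by rewrite /= E.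
    move: xI; rewrite inE; have -> : @src ext_pop (inr (inl u)) =
        exist (fun r => new_vertex_ok r) _ H.
      by apply: val_inj; rewrite /= E.
    by rewrite inE (ext_new_in H).1 cards0.
  have /pinP/(between_parent upl ext_canonical)[a [b [av bv au ub]]] := E.
  exists (emb_e ext_emb a), (emb_e ext_emb b).
  by split=> //; rewrite out_edgesE; apply/eqP/val_inj; rewrite /= E ?av ?bv.
- move=> _ _ xO; right; apply/(strictly_insideP lin).
  case E: (pout w) => [v|]; last first.
    have H : new_vertex_ok (inr (inr w)) by rewrite /= E.
    move: xO; rewrite inE; have -> : @tgt ext_pop (inr (inr w)) =
        exist (fun r => new_vertex_ok r) _ H.
      by apply: val_inj; rewrite /= E.
    by rewrite inE (ext_new_out H).1 cards0.
  have /poutP := E.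
  case/(between_parent (upward_planar_edgewise_op upl) (canonical_op ext_canonical)).
  move=> a [b [av bv au ub]]; rewrite /= in av bv.
  exists (emb_e ext_emb b), (emb_e ext_emb a).
  split; [| |exact: ub|exact: au];
    by rewrite in_edgesE; apply/eqP/val_inj; rewrite /= E ?av ?bv.
Qed.

Definition ext_cpp : cpp_extension G :=
  @CppExtension G ext_pop ext_emb ext_vertices ext_card_edges ext_source_sink
    ext_new_edges.

Lemma restriction_ext_cpp : restriction ext_cpp = lt.
Proof.
by apply/funext => x; apply/funext => y; apply: (cext_mono ext_canonical).
Qed.

End Construction.

(** * The bijection *)

Lemma parent_function (G : digraph) (lt : rel (edge G)) : strict_linear_order lt ->
  exists pin : source_of G -> option (vertex G),
    forall u w, pin u = Some w <-> parent lt (val u) w.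
Proof.
move=> lin; suff ex (u : source_of G) : exists r, forall w, r = Some w <-> parent lt (val u) w.
  by have [pin pinP] := choice ex; exists pin.
have [[w uw]|no] := pselect (exists w, parent lt (val u) w); last first.
  by exists None => w; split=> // uw; case: no; exists w.
exists (Some w) => w'; split=> [[<-]//|uw'].
by rewrite (parent_unique lin uw uw').
Qed.

Lemma first_out_function (G : digraph) (lt : rel (edge G)) :
  no_isolated_vertex G -> strict_linear_order lt ->
  exists fst_out : source_of G -> edge G, (forall u, src (fst_out u) = val u) /\
    forall (u : source_of G) e, src e = val u -> ~~ lt e (fst_out u).
Proof.
move=> noiso lin.
suff ex (u : source_of G) :
    exists m, src m = val u /\ forall e, src e = val u -> ~~ lt e m.
  by have [h hP] := choice ex; exists h; split=> u; case: (hP u).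
have [e eu] := source_src u noiso; have [m mu mP] := out_min e lin.
by exists m; rewrite mu eu in mP *.
Qed.

Lemma cpp_of_upward_planar (G : digraph) (lt : rel (edge G)) :
  no_isolated_vertex G -> upward_planar_edgewise lt ->
  exists X : cpp_extension G, restriction X = lt.
Proof.
move=> noiso upl; have [lin _ _ _ _] := upl; have linop := oplt_linear lin.
have [pin pinP] := parent_function lin.
have [pout poutP] := @parent_function (opg G) _ linop.
have [h [hE hP]] := first_out_function noiso lin.
have [l [lE lP]] := @first_out_function (opg G) _ (isolated_op noiso) linop.
have [rk [rkI ltE]] := linear_rank lin.
exists (ext_cpp noiso upl pinP poutP hE hP lE lP rkI ltE).
exact: restriction_ext_cpp.
Qed.

Lemma restriction_iso (G : digraph) (X Y : cpp_extension G) :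
  cpp_iso X Y -> restriction X = restriction Y.
Proof.
case=> l0 [l1 [_ _ ltE _ embE]].
by apply/funext => x; apply/funext => y; rewrite /restriction ltE -!embE.
Qed.

Theorem theorem5p7 (G : digraph) (acyclicG : acyclic G)
    (no_isolatedG : no_isolated_vertex G) :
  exists f : upo G -> cpp_class G, bijective f.
Proof.
(* Isomorphism classes are exactly the fibres of [restriction]. The map sends an order to its fibre,
   and its inverse restricts a chosen representative, whose choice is immaterial. *)
have isoE (X Y : cpp_extension G) : cpp_iso X Y <-> restriction X = restriction Y.
  by split; [exact: restriction_iso|exact: cpp_iso_of_restriction].
have class_of (lt : upo G) : exists X : cpp_extension G, forall Y,
    restriction Y = sval lt <-> cpp_iso X Y.
  case: lt => lt /= /(upward_planar_orderP _ acyclicG).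
  case/(cpp_of_upward_planar no_isolatedG)=> X <-; exists X => Y.
  by rewrite isoE; split.
pose f (lt : upo G) : cpp_class G :=
  exist _ (fun Y => restriction Y = sval lt) (class_of lt).
have upoX (X : cpp_extension G) : upward_planar_order (restriction X).
  by apply/(upward_planar_orderP _ acyclicG); have [] := cpp_canonical X no_isolatedG.
pose rep (C : cpp_class G) := cid (svalP C).
pose g (C : cpp_class G) : upo G := exist _ _ (upoX (sval (rep C))).
exists f, g => [lt|C]; apply: eq_sig_hprop => [*|/=]; try exact: Prop_irrelevance.
  by have /(_ (sval (rep (f lt)))) /= := svalP (rep (f lt)); rewrite isoE => ->.
apply/funext => Y; apply/propext; rewrite (svalP (rep C) Y) isoE; split; exact: esym.
Qed.
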